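(* Let $K$ be a field. Every Lie derivation $\Delta$ of $\mathscr T_K^-$ has the form $$\Delta=\operatorname{ad}a+\partial_r+C_\lambda,\qquad a\in\mathscr T_K,\ r\in K[t,t^{-1}],\ \lambda\in\operatorname{Hom}_K(K[t,t^{-1}],K).$$ Moreover, there is the vector-space decomposition $$\operatorname{Der}_{\mathrm{Lie}}(\mathscr T_K^-)=\operatorname{Inn}(\mathscr T_K)\oplus\{\partial_r:r\in K[t,t^{-1}]\}\oplus\{C_\lambda:\lambda\in\operatorname{Hom}_K(K[t,t^{-1}],K)\}.$$ Equivalently, as vector spaces, $$\operatorname{Der}_{\mathrm{Lie}}(\mathscr T_K^-)\cong \mathscr T_K/K1\oplus K[t,t^{-1}]\tfrac{d}{dt}\oplus\operatorname{Hom}_K(K[t,t^{-1}],K).$$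
   Context: Let $K$ be a field. The algebraic Toeplitz algebra $\mathscr T_K$ is the Leavitt path algebra over $K$ of the graph with two vertices $v,w$ and two edges, $e$ from $v$ to $v$ and $f$ from $v$ to $w$. Concretely, it is the associative unital $K$-algebra generated by $v,w,e,f,e^*,f^*$ subject to: $1=v+w$; $v^2=v$, $w^2=w$, $vw=wv=0$; $ve=ev=e$, $vf=fw=f$, $ve^*=e^*v=e^*$, $wf^*=f^*v=f^*$; $e^*e=v$, $f^*f=w$, $e^*f=f^*e=0$; $v=ee^*+ff^*$. $\mathscr T_K^-$ is the Lie algebra on $\mathscr T_K$ with bracket $[a,b]=ab-ba$. A Lie derivation of $\mathscr T_K^-$ is a $K$-linear map $\Delta:\mathscr T_K\to\mathscr T_K$ with $\Delta([a,b])=[\Delta(a),b]+[a,\Delta(b)]$ for all $a,b$; $\operatorname{Der}_{\mathrm{Lie}}(\mathscr T_K^-)$ is the vector space of all of them. An associative derivation is a $K$-linear map $D:\mathscr T_K\to\mathscr T_K$ with $D(ab)=D(a)b+aD(b)$ for all $a,b$. For $a\in\mathscr T_K$, $(\operatorname{ad}a)(x)=[a,x]$, and $\operatorname{Inn}(\mathscr T_K)=\{\operatorname{ad}a:a\in\mathscr T_K\}$. $\rho:\mathscr T_K\to K[t,t^{-1}]$ is the $K$-algebra homomorphism with $\rho(v)=1$, $\rho(e)=t$, $\rho(e^* )=t^{-1}$, $\rho(w)=\rho(f)=\rho(f^* )=0$. For $\lambda\in\operatorname{Hom}_K(K[t,t^{-1}],K)$, $C_\lambda(a)=\lambda(\rho(a))1$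 for $a\in\mathscr T_K$. Put $X=e^*+f^*$ and $Y=e+f$. Then $XY=1$, $YX=v$, and $\mathscr T_K$ is generated by $X,Y$ with defining relation $XY=1$. For $r=a_0+\sum_{n\ge1}a_nt^n+\sum_{n\ge1}a_{-n}t^{-n}\in K[t,t^{-1}]$ put $\widetilde r=a_01+\sum_{n\ge1}a_ne^n+\sum_{n\ge1}a_{-n}(e^* )^n\in\mathscr T_K$. Then $\partial_r$ is the unique associative derivation of $\mathscr T_K$ with $\partial_r(Y)=\widetilde r$ and $\partial_r(X)=-X\widetilde rX$. $K[t,t^{-1}]\frac{d}{dt}$ denotes the vector space of derivations $r\frac{d}{dt}$ of $K[t,t^{-1}]$, $r\in K[t,t^{-1}]$. *)

(* Defs.v *)
From HB Require Import structures.
From mathcomp Require Import all_boot all_algebra finmap.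
From mathcomp Require Import boolp functions.
From mathcomp.multinomials Require Import monalg.

Set Implicit Arguments.
Unset Strict Implicit.
Unset Printing Implicit Defensive.

Import GRing.Theory.
Local Open Scope ring_scope.
Local Open Scope quotient_scope.

Section Subspaces.
Variables (K : fieldType) (V : lmodType K).

Section Type_of_subspace.
Variable S : submodClosed V.

Record subspace : Type := Subspace {
  subspace_val : V;
  subspace_valP : subspace_val \in S
}.

HB.instance Definition _ := [isSub for subspace_val].
HB.instance Definition _ := [Choice of subspace by <:].
HB.instance Definition _ := [SubChoice_isSubLmodule of subspace by <:].

(* A copy of S, equipped with the closure under opposites needed to take a
   quotient group; in submodClosed it only follows from scaling by -1. *)
Definition zmod_of_submod : {pred V} := fun x => x \in S.

Lemma zmod_of_submod_closed : zmod_closed zmod_of_submod.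
Proof.
split=> [|x y xS yS]; rewrite unfold_in; first exact: rpred0.
by rewrite rpredD // -scaleN1r rpredZ.
Qed.

HB.instance Definition _ :=
  GRing.isZmodClosed.Build V zmod_of_submod zmod_of_submod_closed.

Definition quotspace : Type := Quotient.quot zmod_of_submod.

HB.instance Definition _ := GRing.Zmodule.on quotspace.
HB.instance Definition _ := EqQuotient.on quotspace.

Definition quotspace_pi (x : V) : quotspace := \pi_quotspace x.

Lemma quotspace_piK (u : quotspace) : quotspace_pi (repr u) = u.
Proof. exact: reprK. Qed.

Lemma quotspace_piE x y : (quotspace_pi x = quotspace_pi y) <-> (x - y \in S).
Proof.
have := Quotient.idealrBE zmod_of_submod x y; rewrite unfold_in => ->.
by split=> [/eqP|/eqP].
Qed.

Lemma quotspace_piD x y :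
  quotspace_pi (x + y) = quotspace_pi x + quotspace_pi y.
Proof. exact: raddfD. Qed.

Definition quotspace_scale (a : K) (u : quotspace) : quotspace :=
  quotspace_pi (a *: repr u).

Lemma quotspace_piZ a x :
  quotspace_scale a (quotspace_pi x) = quotspace_pi (a *: x).
Proof.
apply/quotspace_piE; rewrite -scalerBr rpredZ //.
by apply/quotspace_piE; rewrite quotspace_piK.
Qed.

Let scaleA a b u :
  quotspace_scale a (quotspace_scale b u) = quotspace_scale (a * b) u.
Proof. by rewrite -(quotspace_piK u) !quotspace_piZ scalerA. Qed.

Let scale1 : left_id 1 quotspace_scale.
Proof. by move=> u; rewrite -(quotspace_piK u) quotspace_piZ scale1r. Qed.

Let scaleDr : right_distributive quotspace_scale +%R.
Proof.
move=> a u v; rewrite -(quotspace_piK u) -(quotspace_piK v).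
by rewrite -quotspace_piD !quotspace_piZ scalerDr quotspace_piD.
Qed.

Let scaleDl u : {morph quotspace_scale^~ u : a b / a + b}.
Proof.
move=> a b /=; rewrite -(quotspace_piK u).
by rewrite !quotspace_piZ scalerDl quotspace_piD.
Qed.

HB.instance Definition _ :=
  GRing.Zmodule_isLmodule.Build K quotspace scaleA scale1 scaleDr scaleDl.

End Type_of_subspace.

Definition direct_sum3 (W U1 U2 U3 : submodClosed V) : Prop :=
  [/\ {subset U1 <= W}, {subset U2 <= W}, {subset U3 <= W} &
      forall x, x \in W ->
        exists! u : V * V * V,
          [/\ u.1.1 \in U1, u.1.2 \in U2, u.2 \in U3
            & x = u.1.1 + u.1.2 + u.2]].

End Subspaces.

Section Derivations.
Variables (K : fieldType) (A : algType K).

Definition lie (a b : A) : A := a * b - b * a.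

Definition ad (a : A) : A -> A := fun x => lie a x.

Definition derivation (D : A -> A) : Prop :=
  linear D /\ forall a b, D (a * b) = D a * b + a * D b.

Definition lie_derivation (D : A -> A) : Prop :=
  linear D /\ forall a b, D (lie a b) = lie (D a) b + lie a (D b).

Lemma lieDl a b c : lie (a + b) c = lie a c + lie b c.
Proof. by rewrite /lie mulrDl mulrDr opprD addrACA. Qed.

Lemma lieDr a b c : lie a (b + c) = lie a b + lie a c.
Proof. by rewrite /lie mulrDl mulrDr opprD addrACA. Qed.

Lemma lieZl k a b : lie (k *: a) b = k *: lie a b.
Proof. by rewrite /lie scalerBr -scalerAl -scalerAr. Qed.

Lemma lieZr k a b : lie a (k *: b) = k *: lie a b.
Proof. by rewrite /lie scalerBr -scalerAl -scalerAr. Qed.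

Definition lie_der : {pred A -> A} := fun D => `[< lie_derivation D >].

Lemma lie_der_submod : submod_closed lie_der.
Proof.
split=> [|k D E /asboolP[lD HD] /asboolP[lE HE]]; apply/asboolP; split.
- by move=> a x y /=; rewrite scaler0 addr0.
- by move=> a b; rewrite /= /lie !(mulr0, mul0r) subrr addr0.
- move=> a x y; rewrite !fctE lD lE !scalerDr !scalerA (mulrC k).
  by rewrite addrACA.
- move=> a b; rewrite !fctE HD HE lieDl lieDr lieZl lieZr scalerDr.
  by rewrite addrACA.
Qed.

HB.instance Definition _ :=
  GRing.isSubmodClosed.Build K (A -> A) lie_der lie_der_submod.

Definition inner_der : {pred A -> A} := fun D => `[< exists a, D = ad a >].

Lemma inner_der_submod : submod_closed inner_der.
Proof.
split=> [|k D E /asboolP[a ->] /asboolP[b ->]]; apply/asboolP.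
  by exists 0; apply/funext => x; rewrite /ad /lie mul0r mulr0 subrr.
by exists (k *: a + b); apply/funext => x; rewrite !fctE /ad lieDl lieZl.
Qed.

HB.instance Definition _ :=
  GRing.isSubmodClosed.Build K (A -> A) inner_der inner_der_submod.

End Derivations.

Arguments lie_der {K} A.
Arguments inner_der {K} A.

(** Laurent polynomials: finitely supported families of coefficients indexed
    by int, with the convolution product.  The ring structure that monalg puts
    on {malg K[M]} requires a monoid M without nontrivial units, which excludes
    the additive group int. *)

Definition laurent (K : fieldType) : Type := {malg K[int]}.

Section Laurent.
Variable K : fieldType.
Local Notation L := (laurent K).
Implicit Types (p q : L).

HB.instance Definition _ := GRing.Lmodule.on L.

Definition lmono (n : int) : L := << 1 *g n >>.

Definition lmul p q : L :=
  \sum_(m <- msupp p) \sum_(n <- msupp q) << p@_m * q@_n *g m + n >>.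

Lemma lmulw (d1 d2 : {fset int}) p q :
  (msupp p `<=` d1)%fset -> (msupp q `<=` d2)%fset ->
  lmul p q = \sum_(m <- d1) \sum_(n <- d2) << p@_m * q@_n *g m + n >>.
Proof.
move=> le1 le2; rewrite /lmul (big_fset_incl _ le1) /=.
  apply/eq_bigr=> k1 _; apply/big_fset_incl => // k _ /mcoeff_outdom ->.
  by rewrite mulr0 monalgU0.
move=> k _ /mcoeff_outdom g1k.
by rewrite big1 => // k' _; rewrite g1k mul0r monalgU0.
Qed.

Lemma lmulC : commutative lmul.
Proof.
move=> p q; rewrite /lmul exchange_big; apply/eq_bigr => m _.
by apply/eq_bigr => n _; rewrite mulrC addrC.
Qed.

Lemma lmulDl : left_distributive lmul +%R.
Proof.
move=> p q g.
rewrite [in RHS](lmulw (fsubsetUl _ (msupp q)) (fsubset_refl _)).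
rewrite [in RHS](lmulw (fsubsetUr (msupp p) _) (fsubset_refl _)).
rewrite (lmulw (msuppD_le _ _) (fsubset_refl _)).
rewrite -big_split /=; apply/eq_bigr=> k1 _.
rewrite -big_split /=; apply/eq_bigr=> k2 _.
by rewrite mcoeffD mulrDl monalgUD.
Qed.

Lemma lmulDr : right_distributive lmul +%R.
Proof. by move=> p q g; rewrite !(lmulC p) lmulDl. Qed.

Lemma lmul0l : left_zero 0 lmul.
Proof. by move=> p; rewrite /lmul msupp0 big_seq_fset0. Qed.

Lemma lmul0r : right_zero 0 lmul.
Proof. by move=> p; rewrite lmulC lmul0l. Qed.

Lemma lmulUU (c1 c2 : K) (k1 k2 : int) :
  lmul << c1 *g k1 >> << c2 *g k2 >> = << c1 * c2 *g k1 + k2 >>.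
Proof. by rewrite (lmulw msuppU_le msuppU_le) !big_seq_fset1 !mcoeffUU. Qed.

Lemma lmul_suml (I : Type) (r : seq I) (F : I -> L) q :
  lmul (\sum_(i <- r) F i) q = \sum_(i <- r) lmul (F i) q.
Proof. by rewrite (big_morph (lmul^~ q) (fun _ _ => lmulDl _ _ _) (lmul0l _)). Qed.

Lemma lmul_sumr (I : Type) (r : seq I) (F : I -> L) q :
  lmul q (\sum_(i <- r) F i) = \sum_(i <- r) lmul q (F i).
Proof. by rewrite (big_morph (lmul q) (fun _ _ => lmulDr _ _ _) (lmul0r _)). Qed.

Lemma lmulA : associative lmul.
Proof.
move=> p q g; rewrite (monalgE p) (monalgE q) (monalgE g).
rewrite [LHS]lmul_suml [X in _ = lmul X _]lmul_suml [RHS]lmul_suml.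
apply/eq_bigr => i _.
rewrite [X in lmul _ X]lmul_suml [LHS]lmul_sumr [X in _ = lmul X _]lmul_sumr.
rewrite [RHS]lmul_suml; apply/eq_bigr => j _.
rewrite [X in lmul _ X]lmul_sumr [LHS]lmul_sumr [RHS]lmul_sumr.
apply/eq_bigr => k _.
by rewrite !lmulUU mulrA addrA.
Qed.

Lemma lmul1l : left_id (lmono 0) lmul.
Proof.
move=> p; rewrite [in LHS](monalgE p) [RHS]monalgE lmul_sumr.
by apply/eq_bigr => i _; rewrite lmulUU mul1r add0r.
Qed.

Lemma lone_neq0 : lmono 0 != 0.
Proof. by rewrite monalgU_eq0 oner_eq0. Qed.

HB.instance Definition _ := GRing.Zmodule_isComNzRing.Build L
  lmulA lmulC lmul1l lmulDl lone_neq0.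

Lemma lmonoM (m n : int) : lmono m * lmono n = lmono (m + n).
Proof. by rewrite [LHS]lmulUU mulr1. Qed.

Lemma lscale_mono (c : K) (n : int) : c *: << 1 *g n >> = << c *g n >> :> L.
Proof. by apply/malgP => k; rewrite mcoeffZ !mcoeffU mulrnAr mulr1. Qed.

Lemma laurentE p : p = \sum_(n <- msupp p) p@_n *: lmono n.
Proof.
rewrite [LHS]monalgE; apply/eq_bigr => n _.
by rewrite /lmono lscale_mono.
Qed.

Let lscaleAl (c : K) p q : c *: (p * q) = (c *: p) * q.
Proof.
have H g : c *: g = (<< c *g 0 >> : L) * g.
  apply/malgP => k; rewrite [in LHS](monalgE g) [in RHS](monalgE g).
  rewrite scaler_sumr [X in _ = mcoeff k X]lmul_sumr.
  congr (_@_k); apply/eq_bigr => n _; rewrite lmulUU add0r.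
  by apply/malgP => j; rewrite mcoeffZ !mcoeffU mulrnAr.
by rewrite !H mulrA.
Qed.

HB.instance Definition _ := GRing.Lmodule_isLalgebra.Build K L lscaleAl.
HB.instance Definition _ := GRing.Lalgebra_isComAlgebra.Build K L.

Definition ddt p : L := \sum_(n <- msupp p) << p@_n *~ n *g n - 1 >>.

Definition vfield (r : L) : L -> L := fun p => r * ddt p.

Lemma ddtw (d : {fset int}) p : (msupp p `<=` d)%fset ->
  ddt p = \sum_(n <- d) << p@_n *~ n *g n - 1 >>.
Proof.
move=> le; apply/big_fset_incl => // k _ /mcoeff_outdom ->.
by rewrite mul0rz monalgU0.
Qed.

Lemma ddt_linear : linear ddt.
Proof.
move=> c p q.
have le : (msupp (c *: p + q) `<=` msupp p `|` msupp q)%fset.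
  apply: fsubset_trans (msuppD_le _ _) _.
  by apply: fsetSU; apply: msuppZ_le.
rewrite (ddtw le) (ddtw (fsubsetUl _ (msupp q))) (ddtw (fsubsetUr (msupp p) _)).
rewrite scaler_sumr -big_split /=; apply/eq_bigr => n _.
apply/malgP => k; rewrite !(mcoeffD, mcoeffZ, mcoeffU).
by rewrite mulrzDl mulrnDl mulrnAr mulrzAr.
Qed.

Lemma ddt_lmono n : ddt (lmono n) = n%:~R *: lmono (n - 1).
Proof. by rewrite (ddtw msuppU_le) big_seq_fset1 mcoeffUU /lmono lscale_mono. Qed.

HB.instance Definition _ := GRing.isLinear.Build K L L _ ddt ddt_linear.

Lemma ddt_derivation : derivation ddt.
Proof.
split=> [|p q]; first exact: ddt_linear.
have sumE (r : seq int) (F : int -> L) :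
  ddt (\sum_(i <- r) F i) = \sum_(i <- r) ddt (F i) by exact: linear_sum.
have ZE c g : ddt (c *: g) = c *: ddt g by exact: linearZ.
rewrite (laurentE p) mulr_suml !(sumE (msupp p)) mulr_suml /= mulr_suml.
rewrite -big_split /=; apply/eq_bigr => i _.
rewrite (laurentE q) mulr_sumr !(sumE (msupp q)) mulr_sumr /= mulr_sumr.
rewrite -big_split /=; apply/eq_bigr => j _.
rewrite -!(scalerAl, scalerAr) lmonoM !ZE -!(scalerAl, scalerAr) !ddt_lmono.
rewrite -!(scalerAl, scalerAr) !lmonoM [q@_j *: (p@_i *: _)]scalerA.
rewrite [X in _ = X *: _ + _]mulrC -scalerA (addrAC i (-1)) (addrA i).
by rewrite -!scalerDr -scalerDl -intrD.
Qed.

Lemma vfield_derivation r : derivation (vfield r).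
Proof.
case: ddt_derivation => [lD HD]; split=> [c p q|p q]; rewrite /vfield.
  by rewrite lD mulrDr scalerAr.
by rewrite HD mulrDr mulrA mulrCA mulrA.
Qed.

(* K[t, t^-1] d/dt *)
Definition vfields : {pred L -> L} := fun D => `[< exists r, D = vfield r >].

Lemma vfields_submod : submod_closed vfields.
Proof.
split=> [|k D E /asboolP[r ->] /asboolP[s ->]]; apply/asboolP.
  by exists 0; apply/funext => p; rewrite /vfield mul0r.
exists (k *: r + s); apply/funext => p.
by rewrite !fctE /vfield mulrDl scalerAl.
Qed.

HB.instance Definition _ :=
  GRing.isSubmodClosed.Build K (L -> L) vfields vfields_submod.

Lemma vfield_in r : vfield r \in vfields.
Proof. by apply/asboolP; exists r. Qed.

(* Hom_K(K[t, t^-1], K) *)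
Definition functionals : {pred L -> K^o} := fun l => `[< linear l >].

Lemma functionals_submod : submod_closed functionals.
Proof.
split=> [|k D E /asboolP lD /asboolP lE]; apply/asboolP.
  by move=> a x y /=; rewrite scaler0 addr0.
move=> a x y; rewrite !fctE lD lE !scalerDr !scalerA (mulrC k).
by rewrite addrACA.
Qed.

HB.instance Definition _ :=
  GRing.isSubmodClosed.Build K (L -> K^o) functionals functionals_submod.

End Laurent.

Arguments vfields : clear implicits.
Arguments functionals : clear implicits.

(** The algebraic Toeplitz algebra, presented by generators and relations: the
    quotient of the set of formal expressions by the least congruence that
    contains the defining relations and the axioms of unital associative
    K-algebras; TScal c stands for c1. *)

Variant tgen := gv | gw | ge | gf | ges | gfs.

Inductive texpr (K : Type) :=
| TGen of tgen
| TScal of K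
| TAdd of texpr K & texpr K
| TMul of texpr K & texpr K.

Arguments TGen {K}.

Declare Scope texpr_scope.
Delimit Scope texpr_scope with X.
Bind Scope texpr_scope with texpr.

Section Presentation.
Variable K : fieldType.
Local Open Scope texpr_scope.
Local Notation "0" := (TScal (0%R : K)) : texpr_scope.
Local Notation "1" := (TScal (1%R : K)) : texpr_scope.
Local Notation "x + y" := (TAdd x y) : texpr_scope.
Local Notation "x * y" := (TMul x y) : texpr_scope.
Local Notation v := (TGen gv).
Local Notation w := (TGen gw).
Local Notation e := (TGen ge).
Local Notation f := (TGen gf).
Local Notation e' := (TGen ges).
Local Notation f' := (TGen gfs).

Inductive trel : texpr K -> texpr K -> Prop :=
| rel_1 : trel 1 (v + w)
| rel_vv : trel (v * v) v
| rel_ww : trel (w * w) w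
| rel_vw : trel (v * w) 0
| rel_wv : trel (w * v) 0
| rel_ve : trel (v * e) e
| rel_ev : trel (e * v) e
| rel_vf : trel (v * f) f
| rel_fw : trel (f * w) f
| rel_ve' : trel (v * e') e'
| rel_e'v : trel (e' * v) e'
| rel_wf' : trel (w * f') f'
| rel_f'v : trel (f' * v) f'
| rel_e'e : trel (e' * e) v
| rel_f'f : trel (f' * f) w
| rel_e'f : trel (e' * f) 0
| rel_f'e : trel (f' * e) 0
| rel_v : trel v (e * e' + f * f').

Inductive teq : texpr K -> texpr K -> Prop :=
| teq_rel x y : trel x y -> teq x y
| teq_refl x : teq x x
| teq_sym x y : teq x y -> teq y x
| teq_trans x y z : teq x y -> teq y z -> teq x z
| teq_add x x' y y' : teq x x' -> teq y y' -> teq (x + y) (x' + y')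
| teq_mul x x' y y' : teq x x' -> teq y y' -> teq (x * y) (x' * y')
| teq_addA x y z : teq (x + (y + z)) (x + y + z)
| teq_addC x y : teq (x + y) (y + x)
| teq_add0 x : teq (0 + x) x
| teq_addN x : teq (TScal (-1)%R * x + x) 0
| teq_mulA x y z : teq (x * (y * z)) (x * y * z)
| teq_mul1 x : teq (1 * x) x
| teq_1mul x : teq (x * 1) x
| teq_mulDl x y z : teq ((x + y) * z) (x * z + y * z)
| teq_mulDr x y z : teq (x * (y + z)) (x * y + x * z)
| teq_scalD a b : teq (TScal (a + b)%R) (TScal a + TScal b)
| teq_scalM a b : teq (TScal (a * b)%R) (TScal a * TScal b)
| teq_scalC a x : teq (TScal a * x) (x * TScal a).

HB.instance Definition _ := gen_eqMixin (texpr K).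
HB.instance Definition _ := gen_choiceMixin (texpr K).

Definition teqb (x y : texpr K) : bool := `[< teq x y >].

Lemma teqb_equiv : equiv_class_of teqb.
Proof.
split=> [x|x y|y x z].
- by apply/asboolP/teq_refl.
- by apply/asboolP/asboolP; apply: teq_sym.
- by move=> /asboolP xy /asboolP yz; apply/asboolP/(teq_trans xy yz).
Qed.

Canonical teqb_equivRel := EquivRelPack teqb_equiv.

Definition toeplitz : Type := {eq_quot teqb}.

HB.instance Definition _ := Choice.on toeplitz.
HB.instance Definition _ := EqQuotient.on toeplitz.

Definition tpi (x : texpr K) : toeplitz := \pi_toeplitz x.

Lemma tpiK (a : toeplitz) : tpi (repr a) = a.
Proof. exact: reprK. Qed.

Lemma tpiE x y : tpi x = tpi y <-> teq x y.
Proof.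
split=> [/eqP|xy]; first by rewrite /tpi eqquotE => /asboolP.
by apply/eqP; rewrite /tpi eqquotE; apply/asboolP.
Qed.

Lemma trepr x : teq (repr (tpi x)) x.
Proof. by apply/tpiE; rewrite tpiK. Qed.

Definition tadd (a b : toeplitz) := tpi (repr a + repr b).
Definition tmul (a b : toeplitz) := tpi (repr a * repr b).
Definition topp (a : toeplitz) := tpi (TScal (-1)%R * repr a).
Definition tscale (c : K) (a : toeplitz) := tpi (TScal c * repr a).

Lemma tpiD x y : tadd (tpi x) (tpi y) = tpi (x + y).
Proof. by apply/tpiE/teq_add; apply: trepr. Qed.

Lemma tpiM x y : tmul (tpi x) (tpi y) = tpi (x * y).
Proof. by apply/tpiE/teq_mul; apply: trepr. Qed.

Lemma tpiZ c x : tscale c (tpi x) = tpi (TScal c * x).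
Proof. by apply/tpiE/teq_mul; [apply: teq_refl|apply: trepr]. Qed.

Lemma tind (P : toeplitz -> Prop) : (forall x, P (tpi x)) -> forall a, P a.
Proof. by move=> H a; rewrite -(tpiK a). Qed.

Let taddA : associative tadd.
Proof.
elim/tind=> x; elim/tind=> y; elim/tind=> z.
by rewrite !tpiD; apply/tpiE/teq_addA.
Qed.

Let taddC : commutative tadd.
Proof.
by elim/tind=> x; elim/tind=> y; rewrite !tpiD; apply/tpiE/teq_addC.
Qed.

Let tadd0 : left_id (tpi 0) tadd.
Proof. by elim/tind=> x; rewrite !tpiD; apply/tpiE/teq_add0. Qed.

Let taddN : left_inverse (tpi 0) topp tadd.
Proof.
elim/tind=> x; rewrite [topp _]tpiZ tpiD; exact/tpiE/teq_addN.
Qed.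

HB.instance Definition _ := GRing.isZmodule.Build toeplitz taddA taddC tadd0 taddN.

Lemma tpi_add x y : tpi (x + y) = (tpi x + tpi y)%R.
Proof. exact/esym/tpiD. Qed.

Let tmulA : associative tmul.
Proof.
elim/tind=> x; elim/tind=> y; elim/tind=> z.
by rewrite !tpiM; apply/tpiE/teq_mulA.
Qed.

Let tmul1l : left_id (tpi 1) tmul.
Proof. by elim/tind=> x; rewrite !tpiM; apply/tpiE/teq_mul1. Qed.

Let tmul1r : right_id (tpi 1) tmul.
Proof. by elim/tind=> x; rewrite !tpiM; apply/tpiE/teq_1mul. Qed.

Let tmulDl : left_distributive tmul +%R.
Proof.
elim/tind=> x; elim/tind=> y; elim/tind=> z.
by rewrite -(tpi_add x y) !tpiM -tpi_add; apply/tpiE/teq_mulDl.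
Qed.

Let tmulDr : right_distributive tmul +%R.
Proof.
elim/tind=> x; elim/tind=> y; elim/tind=> z.
by rewrite -(tpi_add y z) !tpiM -tpi_add; apply/tpiE/teq_mulDr.
Qed.

Fixpoint rho_expr (x : texpr K) : laurent K :=
  match x with
  | TGen gv => 1%R
  | TGen ge => lmono K 1
  | TGen ges => lmono K (-1)
  | TGen _ => 0%R
  | TScal c => c%:A%R
  | TAdd x y => (rho_expr x + rho_expr y)%R
  | TMul x y => (rho_expr x * rho_expr y)%R
  end.

Lemma rho_expr_teq x y : teq x y -> rho_expr x = rho_expr y.
Proof.
elim=> {x y} /=; do ?by move=> *; congruence.
- move=> x y [] /=;
  rewrite ?(scale0r, scale1r, mulr1, mul1r, mulr0, mul0r, addr0, lmonoM) //.
- by move=> x y z; rewrite addrA.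
- by move=> x y; rewrite addrC.
- by move=> x; rewrite scale0r add0r.
- by move=> x; rewrite scaleN1r mulN1r addNr scale0r.
- by move=> x y z; rewrite mulrA.
- by move=> x; rewrite scale1r mul1r.
- by move=> x; rewrite scale1r mulr1.
- by move=> x y z; rewrite mulrDl.
- by move=> x y z; rewrite mulrDr.
- by move=> a b; rewrite scalerDl.
- by move=> a b; rewrite -scalerAl mul1r scalerA.
- by move=> a x; rewrite mulrC.
Qed.

Definition rho (a : toeplitz) : laurent K := rho_expr (repr a).

Lemma rho_tpi x : rho (tpi x) = rho_expr x.
Proof. exact/rho_expr_teq/trepr. Qed.

Let tone_neq0 : tpi 1 != tpi 0.
Proof.
apply/eqP => /(congr1 rho); rewrite !rho_tpi /= scale1r scale0r.
by apply/eqP/oner_neq0.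
Qed.

HB.instance Definition _ := GRing.Zmodule_isNzRing.Build toeplitz
  tmulA tmul1l tmul1r tmulDl tmulDr tone_neq0.

Let tscaleA a b u : tscale a (tscale b u) = tscale (a * b)%R u.
Proof.
elim/tind: u => x; rewrite !tpiZ; apply/tpiE.
apply: (teq_trans (teq_mulA _ _ _)); apply: teq_mul (teq_refl _).
exact/teq_sym/teq_scalM.
Qed.

Let tscale1 : left_id 1%R tscale.
Proof. by elim/tind=> x; rewrite tpiZ; apply/tpiE/teq_mul1. Qed.

Let tscaleDr : right_distributive tscale +%R.
Proof.
move=> c; elim/tind=> x; elim/tind=> y.
by rewrite -(tpi_add x y) !tpiZ -tpi_add; apply/tpiE/teq_mulDr.
Qed.

Let tscaleDl u : {morph tscale^~ u : a b / (a + b)%R}.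
Proof.
move=> a b /=; elim/tind: u => x; rewrite !tpiZ -tpi_add; apply/tpiE.
apply: (teq_trans _ (teq_mulDl _ _ _)); apply: teq_mul (teq_refl _).
exact: teq_scalD.
Qed.

HB.instance Definition _ := GRing.Zmodule_isLmodule.Build K toeplitz
  tscaleA tscale1 tscaleDr tscaleDl.

Let tscaleAl (c : K) (a b : toeplitz) : (c *: (a * b) = (c *: a) * b)%R.
Proof.
elim/tind: a => x; elim/tind: b => y.
rewrite [(_ * _)%R]tpiM [(_ *: _)%R]tpiZ [(_ *: _)%R]tpiZ [(_ * _)%R]tpiM.
exact/tpiE/teq_mulA.
Qed.

HB.instance Definition _ := GRing.Lmodule_isLalgebra.Build K toeplitz tscaleAl.

Let tscaleAr (c : K) (a b : toeplitz) : (c *: (a * b) = a * (c *: b))%R.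
Proof.
elim/tind: a => x; elim/tind: b => y.
rewrite [(_ * _)%R]tpiM [(_ *: _)%R]tpiZ [(_ *: _)%R]tpiZ [(_ * _)%R]tpiM.
apply/tpiE; apply: (teq_trans (teq_mulA _ _ _)).
apply: (teq_trans _ (teq_sym (teq_mulA _ _ _))).
by apply: teq_mul (teq_refl _); apply: teq_scalC.
Qed.

HB.instance Definition _ := GRing.Lalgebra_isAlgebra.Build K toeplitz tscaleAr.

Lemma tpi_mul x y : tpi (x * y) = (tpi x * tpi y)%R.
Proof. by rewrite -tpiM. Qed.

Lemma tpi_scal c : tpi (TScal c) = c%:A%R.
Proof. by rewrite [RHS]tpiZ; apply/tpiE/teq_sym/teq_1mul. Qed.

End Presentation.

Section Toeplitz.
Variable K : fieldType.
Local Notation T := (toeplitz K).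
Local Notation L := (laurent K).

(* tes and tfs are the ghost edges e^* and f^*. *)
Definition tv : T := tpi (TGen gv).
Definition tw : T := tpi (TGen gw).
Definition te : T := tpi (TGen ge).
Definition tf : T := tpi (TGen gf).
Definition tes : T := tpi (TGen ges).
Definition tfs : T := tpi (TGen gfs).

Lemma trelE x y : trel x y -> tpi x = tpi y :> T.
Proof. by move=> /teq_rel /tpiE. Qed.

Lemma rho_linear : linear (@rho K).
Proof.
move=> c; elim/tind=> x; elim/tind=> y.
rewrite [(_ *: _)%R]tpiZ -tpi_add !rho_tpi /=.
by rewrite -scalerAl mul1r.
Qed.

Lemma rho_monoid : monoid_morphism (@rho K).
Proof.
split; first by rewrite rho_tpi /= scale1r.
by elim/tind=> x; elim/tind=> y; rewrite -tpi_mul !rho_tpi.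
Qed.

HB.instance Definition _ := GRing.isLinear.Build K T L _ (@rho K) rho_linear.
HB.instance Definition _ := GRing.isMonoidMorphism.Build T L (@rho K) rho_monoid.

Lemma rho_gens :
  [/\ rho tv = 1, rho te = lmono K 1, rho tes = lmono K (-1)
    & [/\ rho tw = 0, rho tf = 0 & rho tfs = 0]].
Proof. by rewrite !rho_tpi. Qed.

(* C_lambda *)
Definition central (l : subspace (functionals K)) : T -> T :=
  fun a => (subspace_val l (rho a) : K)%:A.

Definition tX : T := tes + tfs.
Definition tY : T := te + tf.

(* e^n for n >= 0 and (e^* )^(-n) for n < 0 *)
Definition epow (n : int) : T :=
  match n with Posz k => te ^+ k | Negz k => tes ^+ k.+1 end.

Definition tilde (r : L) : T := \sum_(n <- msupp r) r@_n *: epow n.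

Lemma tilde_linear : linear tilde.
Proof.
have tildew (d : {fset int}) p : (msupp p `<=` d)%fset ->
    tilde p = \sum_(n <- d) p@_n *: epow n.
  move=> le; apply/big_fset_incl => // k _ /mcoeff_outdom ->.
  by rewrite scale0r.
move=> c p q.
have le : (msupp (c *: p + q) `<=` msupp p `|` msupp q)%fset.
  apply: fsubset_trans (msuppD_le _ _) _.
  by apply: fsetSU; apply: msuppZ_le.
rewrite (tildew _ _ le) (tildew _ _ (fsubsetUl _ (msupp q))).
rewrite (tildew _ _ (fsubsetUr (msupp p) _)).
rewrite scaler_sumr -big_split /=; apply/eq_bigr => n _.
by rewrite mcoeffD mcoeffZ scalerDl scalerA.
Qed.

Lemma t1E : 1 = tv + tw :> T.
Proof. by rewrite -tpi_add -(trelE (rel_1 K)). Qed.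

Lemma tveE : tv = te * tes + tf * tfs :> T.
Proof. by rewrite -!tpi_mul -tpi_add -(trelE (rel_v K)). Qed.

Lemma tffsE : tf * tfs = tv - te * tes :> T.
Proof. by rewrite tveE addrAC subrr add0r. Qed.

Lemma tpi0 : tpi (TScal 0) = 0 :> T.
Proof. by []. Qed.

Local Ltac trel R := by rewrite -tpi_mul (trelE (R K)).

Lemma tvv : tv * tv = tv :> T. Proof. trel rel_vv. Qed.
Lemma tww : tw * tw = tw :> T. Proof. trel rel_ww. Qed.
Lemma tvw : tv * tw = 0 :> T. Proof. trel rel_vw. Qed.
Lemma twv : tw * tv = 0 :> T. Proof. trel rel_wv. Qed.
Lemma tve : tv * te = te :> T. Proof. trel rel_ve. Qed.
Lemma tev : te * tv = te :> T. Proof. trel rel_ev. Qed.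
Lemma tvf : tv * tf = tf :> T. Proof. trel rel_vf. Qed.
Lemma tfw : tf * tw = tf :> T. Proof. trel rel_fw. Qed.
Lemma tves : tv * tes = tes :> T. Proof. trel rel_ve'. Qed.
Lemma tesv : tes * tv = tes :> T. Proof. trel rel_e'v. Qed.
Lemma twfs : tw * tfs = tfs :> T. Proof. trel rel_wf'. Qed.
Lemma tfsv : tfs * tv = tfs :> T. Proof. trel rel_f'v. Qed.
Lemma tese : tes * te = tv :> T. Proof. trel rel_e'e. Qed.
Lemma tfsf : tfs * tf = tw :> T. Proof. trel rel_f'f. Qed.
Lemma tesf : tes * tf = 0 :> T. Proof. trel rel_e'f. Qed.
Lemma tfse : tfs * te = 0 :> T. Proof. trel rel_f'e. Qed.
Lemma twe : tw * te = 0 :> T. Proof. by rewrite -tve mulrA twv mul0r. Qed.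
Lemma twf : tw * tf = 0 :> T. Proof. by rewrite -tvf mulrA twv mul0r. Qed.
Lemma twes : tw * tes = 0 :> T. Proof. by rewrite -tves mulrA twv mul0r. Qed.
Lemma tvfs : tv * tfs = 0 :> T. Proof. by rewrite -twfs mulrA tvw mul0r. Qed.
Lemma tew : te * tw = 0 :> T. Proof. by rewrite -tev -mulrA tvw mulr0. Qed.
Lemma tfv : tf * tv = 0 :> T. Proof. by rewrite -tfw -mulrA twv mulr0. Qed.

Lemma tesw : tes * tw = 0 :> T.
Proof. by rewrite -tesv -mulrA tvw mulr0. Qed.
Lemma tfsw : tfs * tw = 0 :> T.
Proof. by rewrite -tfsv -mulrA tvw mulr0. Qed.

Lemma tvX : tv * tX = tes. Proof. by rewrite mulrDr tves tvfs addr0. Qed.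
Lemma twX : tw * tX = tfs. Proof. by rewrite mulrDr twes twfs add0r. Qed.
Lemma tXv : tX * tv = tX. Proof. by rewrite mulrDl tesv tfsv. Qed.
Lemma tXw : tX * tw = 0. Proof. by rewrite -tXv -mulrA tvw mulr0. Qed.
Lemma tXe : tX * te = tv. Proof. by rewrite mulrDl tese tfse addr0. Qed.
Lemma tXf : tX * tf = tw. Proof. by rewrite mulrDl tesf tfsf add0r. Qed.
Lemma tXfs : tX * tfs = 0. Proof. by rewrite -twfs mulrA tXw mul0r. Qed.
Lemma tXes : tX * tes = tX * tX. Proof. by rewrite mulrDr tXfs addr0. Qed.

Lemma tXY : tX * tY = 1.
Proof. by rewrite mulrDr tXe tXf -t1E. Qed.

Lemma tYv : tY * tv = te. Proof. by rewrite mulrDl tev tfv addr0. Qed.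
Lemma tYw : tY * tw = tf. Proof. by rewrite mulrDl tew tfw add0r. Qed.

Lemma tYX : tY * tX = tv.
Proof.
rewrite mulrDl -{1}tev -{1}tfw -!mulrA tvX twX.
by rewrite -tveE.
Qed.

Section Partial.
Variable r : L.

(* The values on the generators are forced by those on X and Y through
   v = YX, w = 1 - YX, e = Yv, f = Yw, e^* = vX, f^* = wX; see
   partial_derivation, partialX, partialY and partial_unique below. *)
Definition partial_gen (g : tgen) : T :=
  let s := tilde r in
  match g with
  | gv => tw * s * tX
  | gw => - (tw * s * tX)
  | ge => s * tv + tf * s * tX
  | gf => s * tw - tf * s * tX
  | ges => tw * s * tX * tX - tes * s * tX
  | gfs => - (tw * s * tX * tX) - tfs * s * tX
  end.

Fixpoint partial_expr (x : texpr K) : T :=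
  match x with
  | TGen g => partial_gen g
  | TScal _ => 0
  | TAdd x y => partial_expr x + partial_expr y
  | TMul x y => partial_expr x * tpi y + tpi x * partial_expr y
  end.

Definition partial (a : T) : T := partial_expr (repr a).

Lemma partial_expr_rel x y : trel x y -> partial_expr x = partial_expr y.
Proof.
have cut1 a b c (h : a * b = c :> T) z : z * a * b = z * c by rewrite -mulrA h.
rewrite /partial_expr /partial_gen /=.
move: (tilde r) (erefl (tes + tfs)) tvX twX tXv tXw tXe tXf tXfs tXes.
rewrite -{1}[tes + tfs]/tX.
move: tX => X s XE vX wX Xv Xw Xe Xf Xfs Xes.
pose R := (tvv, tww, tvw, twv, tve, tev, tvf, tfw, tves, tesv,
  twfs, tfsv, tese, tfsf, tesf, tfse, twe, twf, twes, tvfs,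
  tew, tfv, tesw, tfsw, vX, wX, Xv, Xw, Xe, Xf, Xfs, Xes).
pose C := (cut1 _ _ _ tvv, cut1 _ _ _ tvw, cut1 _ _ _ twv, cut1 _ _ _ tww,
  cut1 _ _ _ vX, cut1 _ _ _ wX,
  cut1 _ _ _ Xv, cut1 _ _ _ Xw, cut1 _ _ _ Xe, cut1 _ _ _ Xf,
  cut1 _ _ _ Xfs, cut1 _ _ _ Xes, cut1 _ _ _ tve, cut1 _ _ _ tvf,
  cut1 _ _ _ tves, cut1 _ _ _ twfs, cut1 _ _ _ twe, cut1 _ _ _ twf,
  cut1 _ _ _ twes, cut1 _ _ _ tvfs, tesv).
case=> /=; rewrite -?/tv -?/tw -?/te -?/tf -?/tes -?/tfs ?tpi0.
all: rewrite ?(mulrDl, mulrDr, mulrN, mulNr) ?mulrA.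
all: rewrite ?R ?C ?R ?C ?(mulr0, mul0r, addr0, add0r, oppr0, subrr, mulrA) //.
- by rewrite addNr.
- by rewrite addrA -!mulrDl [tw + tv]addrC -t1E mul1r.
- by rewrite addrA -!mulrDl [tw + tv]addrC -t1E mul1r.
- by rewrite subrK.
- by rewrite addKr.
- by rewrite addNr.
- by rewrite addrA subrK addNr.
have sX : s * tes + s * tfs = tv * s * X + tw * s * X.
  by rewrite -mulrDr -XE -!mulrDl -t1E mul1r.
rewrite tffsE !mulrBl opprB [RHS]addrACA (addrAC (s * tes)) sX.
rewrite [X in _ + X]addrCA addKr addrA addrK.
by rewrite addrAC subrr add0r.
Qed.

Lemma partial_expr_teq x y : teq x y -> partial_expr x = partial_expr y.
Proof.
elim=> {x y} /=.
- exact: partial_expr_rel.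
- by [].
- by move=> x y _ ->.
- by move=> x y z _ -> _ ->.
- by move=> x x' y y' _ -> _ ->.
- by move=> x x' y y' /tpiE exx' -> /tpiE eyy' ->; rewrite exx' eyy'.
- by move=> x y z; rewrite addrA.
- by move=> x y; rewrite addrC.
- by move=> x; rewrite add0r.
- by move=> x; rewrite mul0r add0r tpi_scal scaleN1r mulN1r addNr.
- by move=> x y z; rewrite !tpi_mul !mulrDl !mulrDr !mulrA addrA.
- by move=> x; rewrite tpi_scal scale1r mul0r mul1r add0r.
- by move=> x; rewrite tpi_scal scale1r mulr0 mulr1 addr0.
- by move=> x y z; rewrite tpi_add !mulrDl addrACA.
- by move=> x y z; rewrite tpi_add !mulrDr addrACA.
- by move=> a b; rewrite addr0.
- by move=> a b; rewrite mul0r mulr0 addr0.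
- move=> a x; rewrite tpi_scal mul0r mulr0 add0r addr0.
  by rewrite -scalerAl mul1r -scalerAr mulr1.
Qed.

Lemma partial_tpi x : partial (tpi x) = partial_expr x.
Proof. exact/partial_expr_teq/trepr. Qed.

Lemma partial_derivation : derivation partial.
Proof.
split=> [c|]; elim/tind=> x; elim/tind=> y.
  rewrite [(_ *: _)]tpiZ -tpi_add !partial_tpi /=.
  by rewrite tpi_scal mul0r add0r -scalerAl mul1r.
by rewrite -tpi_mul !partial_tpi.
Qed.

Lemma partialY : partial tY = tilde r.
Proof.
rewrite /tY /te /tf -tpi_add partial_tpi /= addrACA subrr addr0.
by rewrite -mulrDr -t1E mulr1.
Qed.

Lemma partialX : partial tX = - (tX * tilde r * tX).
Proof.
have -> : partial tX = partial_expr (TAdd (TGen ges) (TGen gfs)).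
  by rewrite -partial_tpi tpi_add.
rewrite /=.
rewrite addrACA subrr add0r -opprD -!mulrDl.
by [].
Qed.

Lemma partial_unique (D : T -> T) :
  derivation D -> D tY = tilde r -> D tX = - (tX * tilde r * tX) ->
  D = partial.
Proof.
move=> [lD dD] DY DX; case: partial_derivation => lP dP.
have D0 : D 0 = 0.
  by have := lD (-1) 0 0; rewrite scaler0 addr0 scaleN1r addNr.
have DD a b : D (a + b) = D a + D b by rewrite -{1}(scale1r a) lD scale1r.
have DZ c a : D (c *: a) = c *: D a by rewrite -{1}(addr0 (c *: a)) lD D0 addr0.
have P0 : partial 0 = 0.
  by have := lP (-1) 0 0; rewrite scaler0 addr0 scaleN1r addNr.
have PD a b : partial (a + b) = partial a + partial b.
  by rewrite -{1}(scale1r a) lP scale1r.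
have PZ c a : partial (c *: a) = c *: partial a.
  by rewrite -{1}(addr0 (c *: a)) lP P0 addr0.
have D1 : D 1 = 0.
  by apply: (addrI (D 1)); rewrite addr0 -{3}(mulr1 1) dD mulr1 mul1r.
have P1 : partial 1 = 0.
  by apply: (addrI (partial 1)); rewrite addr0 -{3}(mulr1 1) dP mulr1 mul1r.
pose E a := D a = partial a.
have EM a b : E a -> E b -> E (a * b) by rewrite /E dD dP => -> ->.
have ED a b : E a -> E b -> E (a + b) by rewrite /E DD PD => -> ->.
have EZ c a : E a -> E (c *: a) by rewrite /E DZ PZ => ->.
have E1 : E 1 by rewrite /E D1 P1.
have EX : E tX by rewrite /E DX partialX.
have EY : E tY by rewrite /E DY partialY.
have Ev : E tv by rewrite -tYX; apply: EM.
have Ew : E tw.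
  have -> : tw = 1 + (-1) *: tv by rewrite t1E scaleN1r addrAC subrr add0r.
  by apply/ED/EZ.
apply/funext; elim/tind; elim=> [[]|c|x Ex y Ey|x Ex y Ey].
- exact: Ev.
- exact: Ew.
- by have := EM _ _ EY Ev; rewrite tYv.
- by have := EM _ _ EY Ew; rewrite tYw.
- by have := EM _ _ Ev EX; rewrite tvX.
- by have := EM _ _ Ew EX; rewrite twX.
- by rewrite tpi_scal; apply: EZ.
- by rewrite tpi_add; apply: ED.
- by rewrite tpi_mul; apply: EM.
Qed.

End Partial.

Lemma partial_linear c r s :
  partial (c *: r + s) = c *: partial r + partial s.
Proof.
have [lr dr] := partial_derivation r; have [ls ds] := partial_derivation s.
apply/esym/partial_unique; first split.
- move=> a x y; rewrite !fctE lr ls !scalerDr !scalerA (mulrC c).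
  by rewrite addrACA.
- move=> a b; rewrite !fctE dr ds scalerDr !mulrDl !mulrDr addrACA.
  by rewrite -scalerAl -scalerAr.
- by rewrite !fctE !partialY tilde_linear.
- rewrite !fctE !partialX tilde_linear; move: tX => X.
  rewrite mulrDr mulrDl opprD scalerN.
  by rewrite -scalerAr -scalerAl.
Qed.

Definition partials : {pred T -> T} := fun D => `[< exists r, D = partial r >].

Lemma partials_submod : submod_closed partials.
Proof.
split=> [|k D E /asboolP[r ->] /asboolP[s ->]]; apply/asboolP; last first.
  by exists (k *: r + s); rewrite partial_linear.
exists 0; have := partial_linear (-1) 0 0.
by rewrite scaler0 addr0 scaleN1r addNr => ->.
Qed.

HB.instance Definition _ :=
  GRing.isSubmodClosed.Build K (T -> T) partials partials_submod.

Definition centrals : {pred T -> T} := fun D => `[< exists l, D = central l >].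

Lemma centrals_submod : submod_closed centrals.
Proof.
split=> [|k D E /asboolP[r ->] /asboolP[s ->]]; apply/asboolP.
  exists 0; apply/funext => x; by rewrite /central scale0r.
exists (k *: r + s); apply/funext => x.
by rewrite !fctE /central scalerDl scalerA.
Qed.

HB.instance Definition _ :=
  GRing.isSubmodClosed.Build K (T -> T) centrals centrals_submod.

Definition scalars : {pred T} := fun a => `[< exists c : K, a = c%:A >].

Lemma scalars_submod : submod_closed scalars.
Proof.
split=> [|k D E /asboolP[r ->] /asboolP[s ->]]; apply/asboolP.
  by exists 0; rewrite scale0r.
by exists (k * r + s); rewrite scalerDl scalerA.
Qed.

HB.instance Definition _ :=
  GRing.isSubmodClosed.Build K T scalars scalars_submod.

End Toeplitz.

Arguments partials : clear implicits.
Arguments centrals : clear implicits.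
Arguments scalars : clear implicits.

(* Main.v *)
From HB Require Import structures.
Require Import Defs.
From mathcomp Require Import all_boot all_algebra.
From mathcomp Require Import finmap boolp functions.
From mathcomp.multinomials Require Import monalg.
Import GRing.Theory.
Local Open Scope ring_scope.
Set Implicit Arguments.
Unset Strict Implicit.
Unset Printing Implicit Defensive.

(** Write w = 1 - Y X and E i j = Y^i w X^j.  Since X Y = 1 and w Y = X w = 0,
    these elements multiply like matrix units, E i j * E k l = 0 or E i l, and
    they span the kernel of rho.  So the Toeplitz algebra T is an extension of
    K[t, t^-1] by the algebra of finitary matrices indexed by nat, and it acts
    faithfully on that ideal.

    Let D be a Lie derivation.  On ker rho it is an associative derivation:
    expanding D [E i j, E k l] in matrix coefficients gives linear relations
    between the coefficients of the D (E i j), and because there are infinitely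
    many indices while each D (E i i) has only finitely many nonzero diagonal
    coefficients, these relations force the Leibniz rule on matrix units, in
    every characteristic ([coef_leibniz], [leibniz_ker]).

    For a fixed a in T, the defect x |-> D(a) x - D(a x) + a D(x) is then a map
    of bimodules on ker rho, hence multiplication by a scalar c(a)
    ([defectE]).  As T acts faithfully on ker rho, a |-> D(a) - c(a) 1 is an
    associative derivation; and c vanishes on ker rho, so that a |-> c(a) 1 is
    some C_lambda ([lie_der_split]).

    An associative derivation is known from its values at Y and X.  Its value
    at Y is tilde r modulo ker rho for one r, and each element of ker rho is a
    commutator [a, Y]; after subtracting ad a and partial_r the derivation kills
    Y, and then X goes to an element of T w, which is [b, X] for some b
    commuting with Y ([derivation_split]).

    For uniqueness, suppose ad a + partial_r + C_lambda = 0.  The derivation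
    ad a + partial_r vanishes on ker rho because C_lambda does, so it is zero by
    faithfulness; rho of its value at Y is r, so r = 0, a is central, hence a
    scalar, and lambda = 0 ([sum_eq0]). *)

(** * Linear maps and linear spans *)

Section LinearMaps.
Variables (K : fieldType) (U V : lmodType K) (D : U -> V).
Hypothesis lD : linear D.

Lemma linear_at0 : D 0 = 0.
Proof. by have := lD (-1) 0 0; rewrite scaler0 addr0 scaleN1r addNr. Qed.

Lemma linear_atD x y : D (x + y) = D x + D y.
Proof. by rewrite -{1}(scale1r x) lD scale1r. Qed.

Lemma linear_atB x y : D (x - y) = D x - D y.
Proof. by rewrite addrC -scaleN1r lD scaleN1r addrC. Qed.

Lemma linear_atMn x n : D (x *+ n) = D x *+ n.
Proof. by elim: n => [|n IH]; rewrite ?linear_at0 // !mulrS linear_atD IH. Qed.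

End LinearMaps.

Inductive span_of (K : fieldType) (V : lmodType K) (G : V -> Prop) :
  V -> Prop :=
| span0 : span_of G 0
| span_lin c a b : span_of G a -> span_of G b -> span_of G (c *: a + b)
| span_gen a : G a -> span_of G a.

Lemma span_ofB (K : fieldType) (V : lmodType K) (G : V -> Prop) (x y : V) :
  span_of G x -> span_of G y -> span_of G (x - y).
Proof. by move=> Sx Sy; rewrite addrC -scaleN1r; apply: span_lin. Qed.

(** * Derivations of an algebra *)

Section AlgebraDerivations.
Variables (K : fieldType) (A : algType K).
Implicit Types (a b : A) (D F : A -> A).

Lemma ad_derivation a : derivation (ad a).
Proof.
split=> [c x y|x y]; rewrite /ad; first by rewrite lieDr lieZr.
by rewrite /lie mulrBl mulrBr !mulrA subrKA.
Qed.

Lemma derivationD D F :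
  derivation D -> derivation F -> derivation (D + F).
Proof.
move=> [lD dD] [lF dF]; split=> [c x y|x y]; rewrite !fctE.
  by rewrite lD lF scalerDr addrACA.
by rewrite dD dF mulrDl mulrDr addrACA.
Qed.

Lemma derivation_lie D : derivation D -> lie_derivation D.
Proof.
move=> [lD dD]; split=> // x y.
by rewrite /lie (linear_atB lD) !dD [D y * x + _]addrC opprD addrACA.
Qed.

Lemma derivation1 D : derivation D -> D 1 = 0.
Proof.
move=> [_ dD]; apply: (addrI (D 1)).
by rewrite addr0 -{3}(mulr1 1) dD mulr1 mul1r.
Qed.

Lemma adB (a b : A) : ad (a - b) = ad a - ad b.
Proof.
by apply/funext => x; rewrite !fctE /ad -scaleN1r lieDl lieZl scaleN1r.
Qed.

Lemma ad_scalar (c : K) : ad (c%:A : A) = 0.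
Proof.
by apply/funext => x; rewrite /ad /lie mulr_algl mulr_algr subrr.
Qed.

End AlgebraDerivations.

(** * The shift representation *)

Section ShiftModel.
Variable K : fieldType.
Implicit Types (s : nat -> K) (x y : texpr K).

(** The representation on sequences in which Y is the shift n |-> n + 1 and X
    its left inverse, so that w is the projection on the coordinate 0.  It
    shows that w is nonzero, which rho cannot see. *)
Definition shift_gen (g : tgen) (s : nat -> K) (n : nat) : K :=
  match g, n with
  | gv, n.+1 => s n.+1
  | gw, 0 => s 0
  | ge, n.+2 => s n.+1
  | gf, 1 => s 0
  | ges, n.+1 => s n.+2
  | gfs, 0 => s 1
  | _, _ => 0
  end.

Fixpoint shift_op (x : texpr K) (s : nat -> K) : nat -> K :=
  match x with
  | TGen g => shift_gen g s
  | TScal c => fun n => c * s n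
  | TAdd x y => fun n => shift_op x s n + shift_op y s n
  | TMul x y => shift_op x (shift_op y s)
  end.

Lemma shift_op_linear x c s s' n :
  shift_op x (fun m => c * s m + s' m) n = c * shift_op x s n + shift_op x s' n.
Proof.
elim: x s s' n => [g|a|x IHx y IHy|x IHx y IHy] s s' n /=.
- by case: g n => [] [|[|n]] /=; rewrite ?mulr0 ?addr0.
- by rewrite mulrDr mulrCA.
- by rewrite IHx IHy mulrDr addrACA.
- rewrite -IHx; congr (shift_op x _ n); apply/funext => m; exact: IHy.
Qed.

Lemma shift_op_teq x y : teq x y -> shift_op x = shift_op y.
Proof.
elim=> {x y} /=; [|by []|by move=> x y _ ->|by move=> x y z _ -> _ ->|..].
- move=> x y r; apply/funext => s; apply/funext => n.
  by case: r; case: n => [|[|[|n]]] /=;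
    rewrite ?(mulr0, mul0r, mul1r, addr0, add0r).
- by move=> x x' y y' _ -> _ ->.
- by move=> x x' y y' _ -> _ ->.
- by move=> x y z; apply/funext => s; apply/funext => n; rewrite addrA.
- by move=> x y; apply/funext => s; apply/funext => n; rewrite addrC.
- by move=> x; apply/funext => s; apply/funext => n; rewrite mul0r add0r.
- move=> x; apply/funext => s; apply/funext => n.
  by rewrite mulN1r addNr mul0r.
- by [].
- by move=> x; apply/funext => s; apply/funext => n; rewrite mul1r.
- move=> x; apply/funext => s; congr (shift_op x _).
  by apply/funext => n; rewrite mul1r.
- by [].
- move=> x y z; apply/funext => s; apply/funext => n.
  have := shift_op_linear x 1 (shift_op y s) (shift_op z s) n.
  rewrite mul1r => <-; congr (shift_op x _ n).
  by apply/funext => m; rewrite mul1r.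
- by move=> a b; apply/funext => s; apply/funext => n; rewrite mulrDl.
- by move=> a b; apply/funext => s; apply/funext => n; rewrite mulrA.
- move=> a x; apply/funext => s; apply/funext => n.
  have := shift_op_linear x a s (fun=> 0) n.
  have -> : shift_op x (fun=> 0) n = 0.
    have := shift_op_linear x (-1) s s n.
    rewrite mulN1r addNr => {2}<-; congr (shift_op x _ n).
    by apply/funext => m; rewrite mulN1r addNr.
  rewrite addr0 => <-; congr (shift_op x _ n).
  by apply/funext => m; rewrite addr0.
Qed.

Lemma tw_neq0 : tw K != 0.
Proof.
apply/eqP => /tpiE /shift_op_teq /(congr1 (fun F => F (fun=> 1) 0)) /=.
by rewrite mul0r => /eqP; rewrite oner_eq0.
Qed.

End ShiftModel.

(** * The Leibniz rule for matrix coefficients *)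

Section Coefficients.
(* D i j a b stands for the (a, b) coefficient of the image of E i j; D_lie is
   the (a, b) coefficient of the image of [E i j, E k l], where the index
   pattern of each term comes from multiplying by a matrix unit. *)
Variables (V : zmodType) (D : nat -> nat -> nat -> nat -> V).
Hypothesis D_lie : forall i j k l a b : nat,
  D i l a b *+ (j == k) - D k j a b *+ (l == i) =
  D i j a k *+ (b == l) - D i j l b *+ (a == k)
  + (D k l j b *+ (a == i) - D k l a i *+ (b == j)).
Hypothesis D_fin : forall i, exists n, forall m, (n <= m)%N -> D i i m m = 0.

Local Definition index_simpl := (mulr0n, mulr1n, subr0, addr0, add0r, sub0r).

(** The relation [E i i, E i m] = E i m shows that, outside row and column i,
    the image of E i i is the scalar matrix with entry D i i i i.  A finite
    diagonal inside an infinite index set then makes that scalar zero. *)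
Lemma coef_diag i a b : (a == i) = (b == i) -> D i i a b = 0.
Proof.
have off m l : m != i -> l != i -> D i i m l = D i i i i *+ (l == m).
  move=> mi li; have := D_lie i i i m i l.
  rewrite !eqxx !(negbTE mi) !(negbTE li) !index_simpl -[X in X = _]add0r.
  by move=> /addIr /esym/eqP; rewrite subr_eq0 => /eqP ->.
have Dii : D i i i i = 0.
  have [n n0] := D_fin i; pose m := maxn n i.+1.
  have mi : m != i by rewrite neq_ltn [(i < m)%N]leq_maxr orbT.
  by have := off m m mi mi; rewrite eqxx n0 ?leq_maxl.
have [->|ai] := eqVneq a i; first by move=> /esym/eqP ->.
by move=> /esym/negbT bi; rewrite off // Dii mul0rn.
Qed.

(** The image of E i j lives in row i and column j.  Bracketing with E i i or
    E j j gives this away from the coefficient (j, i), where it only gives twice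
    the coefficient; that one is killed by E i j = [E i k, E k j] with a third
    index k, which works in every characteristic. *)
Lemma coef_cross i j a b : a != i -> b != j -> D i j a b = 0.
Proof.
have [<-{j}|ij] := eqVneq i j.
  by move=> ai bi; apply: coef_diag; rewrite (negbTE ai) (negbTE bi).
have ji : j != i by rewrite eq_sym.
have flip : D i j j i = 0.
  pose k := maxn i.+1 j.+1.
  have ki : k != i by rewrite neq_ltn [(i < k)%N]leq_maxl orbT.
  have kj : k != j by rewrite neq_ltn [(j < k)%N]leq_maxr orbT.
  have ik : i != k by rewrite eq_sym.
  have jk : j != k by rewrite eq_sym.
  have := D_lie i k k j j i.
  by rewrite eqxx (negbTE ji) (negbTE ij) (negbTE jk) (negbTE ik) !index_simpl.
move=> ai bj; have [bi|bi] := eqVneq b i; last first.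
  have := D_lie i i i j a b.
  rewrite eqxx (negbTE ji) (negbTE ai) (negbTE bj) (negbTE bi) !index_simpl.
  exact.
have [aj|aj] := eqVneq a j; first by rewrite aj bi.
have := D_lie i j j j a b.
rewrite eqxx (negbTE ji) (negbTE ai) (negbTE bj) (negbTE aj) !index_simpl.
exact.
Qed.

(** From [E i j, E k i] = - E k j, whose image has no (i, i) coefficient unless
    i is k or j; in those two cases the extra terms cancel. *)
Lemma coef_opp i j k : j != k -> D i j i k + D k i j i = 0.
Proof.
move=> jk; have := D_lie i j k i i i; rewrite !eqxx (negbTE jk) !index_simpl.
have [ik|ik] := eqVneq i k; have [ij|ij] := eqVneq i j.
- by rewrite -ij -ik eqxx in jk.
- by rewrite -ik !index_simpl subrr add0r => <-; rewrite addrN.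
- by rewrite -ij !index_simpl subrr addr0 => <-; rewrite addNr.
- by rewrite !index_simpl coef_cross // oppr0.
Qed.

(** From [E i i, E j j] = 0. *)
Lemma coef_diag_opp i j : i != j -> D i i j i + D j j j i = 0.
Proof.
move=> ij; have ji : j != i by rewrite eq_sym.
have := D_lie i i j j j i; rewrite !eqxx (negbTE ij) (negbTE ji) !index_simpl.
by rewrite -opprD => /esym/eqP; rewrite oppr_eq0 => /eqP.
Qed.

(** The Leibniz rule for the products E i j * E k l = 0.  By [coef_cross] only
    the coefficient (i, l) matters, and [E i j, E k l] = 0 when i and l
    differ. *)
Lemma coef_leibniz_ne i j k l a b : j != k ->
  D i j a k *+ (b == l) + D k l j b *+ (a == i) = 0.
Proof.
move=> jk; have kj : k != j by rewrite eq_sym.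
have [->{a}|ai] := eqVneq a i; have [->{b}|bl] := eqVneq b l;
  rewrite !index_simpl //; first last.
- by rewrite coef_cross.
- by rewrite coef_cross.
have [->|li] := eqVneq l i; first exact: coef_opp.
have il : i != l by rewrite eq_sym.
have := D_lie i j k l i l; rewrite !eqxx (negbTE jk) (negbTE li) !index_simpl.
have [ik|ik] := eqVneq i k; have [lj|lj] := eqVneq l j.
(* Here both factors are E i j, so that their bracket carries no information;
   the relation comes from the brackets with E i i and E j j instead. *)
- rewrite lj -ik => _; rewrite lj in il li.
  have H1 := coef_opp i li; have H2 := coef_opp j li.
  have /eqP := coef_diag_opp il; rewrite addr_eq0 => /eqP H3.
  by move: H1; rewrite {}H3 => /eqP; rewrite subr_eq0 => /eqP ->.
- by rewrite !index_simpl (coef_cross (i:=i) (j:=j) (a:=l)) // subr0 => <-.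
- by rewrite !index_simpl (coef_cross (i:=k) (b:=i)) -?lj // subr0 => <-.
- by rewrite !index_simpl => <-.
Qed.

(** When j = k and i, l differ, the bracket is E i l and the terms in the
    other order are a product that vanishes, so that [coef_leibniz_ne] removes
    them.  When i = l, the bracket [E i j, E j i] = E i i - E j j determines the
    coefficients in row and column i, apart from those at (i, j) and (j, i). *)
Lemma coef_leibniz i j k l a b :
  D i l a b *+ (j == k) = D i j a k *+ (b == l) + D k l j b *+ (a == i).
Proof.
have [<-{k}|jk] := eqVneq j k; last by rewrite coef_leibniz_ne.
rewrite mulr1n; have [<-{l}|il] := eqVneq i l; last first.
  have li : l != i by rewrite eq_sym.
  have := D_lie i j j l a b; rewrite eqxx (negbTE li) !index_simpl => ->.
  rewrite addrACA -opprD [X in - X]addrC.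
  by rewrite (coef_leibniz_ne j j a b li) subr0.
have [<-{j}|ij] := eqVneq i j.
  have [->{a}|ai] := eqVneq a i; have [->{b}|bi] := eqVneq b i;
    rewrite !index_simpl //.
    by rewrite coef_diag // addr0.
  by rewrite coef_diag // (negbTE ai) (negbTE bi).
have ji : j != i by rewrite eq_sym.
have := D_lie i j j i a b; rewrite !eqxx !index_simpl.
have [->{a}|ai] := eqVneq a i; have [->{b}|bi] := eqVneq b i.
- rewrite (negbTE ij) (coef_diag (i:=i)) // (coef_diag (i:=j) (a:=i)) //.
  by rewrite !index_simpl.
- have [->{b bi}|bj] := eqVneq b j.
    move=> _; rewrite !index_simpl; have /eqP := coef_diag_opp ji.
    rewrite addrC addr_eq0 => /eqP ->; have /eqP := coef_opp j ij.
    by rewrite addr_eq0 => /eqP ->.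
  rewrite (coef_diag (i:=j)) ?(negbTE ij) ?(negbTE bj) //.
  by rewrite !index_simpl => ->.
- have [->{a ai}|aj] := eqVneq a j.
    move=> _; rewrite !index_simpl; have /eqP := coef_diag_opp ij.
    rewrite addr_eq0 => /eqP ->; have /eqP := coef_opp j ji.
    by rewrite addrC addr_eq0 => /eqP ->.
  rewrite (coef_diag (i:=j)) ?(negbTE ij) ?(negbTE aj) //.
  by rewrite !index_simpl => ->.
- by rewrite !index_simpl coef_diag // (negbTE ai) (negbTE bi).
Qed.

End Coefficients.

(** * Monomials and matrix units *)

Section Toeplitz.
Variable K : fieldType.
Local Notation T := (toeplitz K).
Local Notation L := (laurent K).
Local Notation v := (tv K).
Local Notation w := (tw K).
Local Notation X := (tX K).
Local Notation Y := (tY K).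
Implicit Types (a b x y z : T).

Lemma twE : w = 1 - Y * X.
Proof. by rewrite tYX t1E addrAC subrr add0r. Qed.

Lemma twY : w * Y = 0.
Proof. by rewrite twE mulrBl mul1r -mulrA tXY mulr1 subrr. Qed.

Lemma XnYn n : X ^+ n * Y ^+ n = 1.
Proof.
elim: n => [|n IH]; first by rewrite mulr1.
by rewrite exprSr exprS mulrA -(mulrA _ X) tXY mulr1.
Qed.

Lemma XY_ind (P : T -> Prop) :
  (forall c, P c%:A) -> P X -> P Y ->
  (forall a b, P a -> P b -> P (a + b)) ->
  (forall a b, P a -> P b -> P (a * b)) -> forall a, P a.
Proof.
move=> Pc PX PY PD PM.
have Pv : P v by rewrite -tYX; apply: PM.
have Pw : P w.
  by rewrite twE -(scale1r 1) -mulN1r -scaleN1r; apply/PD/PM => //; apply: PM.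
elim/tind; elim=> [[]|c|x Px y Py|x Px y Py] //.
- by rewrite -[tpi _]/(te K) -tYv; apply: PM.
- by rewrite -[tpi _]/(tf K) -tYw; apply: PM.
- by rewrite -[tpi _]/(tes K) -tvX; apply: PM.
- by rewrite -[tpi _]/(tfs K) -twX; apply: PM.
- by rewrite tpi_scal.
- by rewrite tpi_add; apply: PD.
- by rewrite tpi_mul; apply: PM.
Qed.

(** Left multiplication by X or Y sends a monomial Y^i X^j to another one,
    because X Y = 1; so the span of the monomials is a left ideal that
    contains 1. *)
Lemma span_monomials a : span_of (fun x => exists i j, x = Y ^+ i * X ^+ j) a.
Proof.
set S := span_of _.
have SM i j : S (Y ^+ i * X ^+ j) by apply: span_gen; exists i, j.
suff H b : S b -> S (a * b).
  by rewrite -(mulr1 a) -(mulr1 1); apply/H/(SM 0 0).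
elim/XY_ind: a b => [c|||a a' IHa IHa'|a a' IHa IHa'] b Sb.
- rewrite -scalerAl mul1r -(addr0 (_ *: _)).
  exact: span_lin Sb (span0 _).
- elim: Sb => [|c x y _ IHx _ IHy|_ [[|i] [j ->]]].
  + by rewrite mulr0; apply: span0.
  + by rewrite mulrDr -scalerAr; apply: span_lin.
  + by rewrite mul1r -exprS -(mul1r (X ^+ _)); apply: (SM 0).
  + by rewrite exprS -mulrA mulrA tXY mul1r.
- elim: Sb => [|c x y _ IHx _ IHy|_ [i [j ->]]].
  + by rewrite mulr0; apply: span0.
  + by rewrite mulrDr -scalerAr; apply: span_lin.
  + by rewrite mulrA -exprS.
- rewrite mulrDl -(scale1r (a * b)).
  by apply: span_lin; [apply: IHa|apply: IHa'].
- by rewrite -mulrA; apply/IHa/IHa'.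
Qed.

Definition matrix_unit i j : T := Y ^+ i * w * X ^+ j.
Local Notation E := matrix_unit.

Lemma wXYw k i : w * X ^+ k * Y ^+ i * w = w *+ (k == i).
Proof.
elim: k i => [|k IH] [|i].
- by rewrite !mulr1 tww.
- by rewrite mulr1 exprS mulrA twY !mul0r.
- by rewrite mulr1 exprSr -!mulrA tXw !mulr0.
- by rewrite exprSr exprS !mulrA -(mulrA _ X) tXY mulr1 IH.
Qed.

Lemma mul_wXYw z k i : z * w * X ^+ k * Y ^+ i * w = z * w *+ (k == i).
Proof. by rewrite -mulrnAr -wXYw !mulrA. Qed.

(** The (k, l) coefficient of x, kept as an element of w T w = K w: equations
    between coefficients can then be read off by multiplying in T. *)
Definition entry x k l : T := w * X ^+ k * x * Y ^+ l * w.

Lemma entry0 k l : entry 0 k l = 0.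
Proof. by rewrite /entry mulr0 !mul0r. Qed.

Lemma entryD x y k l : entry (x + y) k l = entry x k l + entry y k l.
Proof. by rewrite /entry mulrDr !mulrDl. Qed.

Lemma entryB x y k l : entry (x - y) k l = entry x k l - entry y k l.
Proof. by rewrite /entry mulrBr !mulrBl. Qed.

Lemma entryMn x n k l : entry (x *+ n) k l = entry x k l *+ n.
Proof. by elim: n => [|n IH]; rewrite ?entry0 // !mulrS entryD IH. Qed.

Lemma entry_mull i j x k l : entry (E i j * x) k l = entry x j l *+ (k == i).
Proof. by rewrite /entry /matrix_unit !mulrA wXYw !mulrnAl. Qed.

Lemma entry_mulr x i j k l : entry (x * E i j) k l = entry x k i *+ (l == j).
Proof. by rewrite /entry /matrix_unit !mulrA mul_wXYw eq_sym. Qed.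

Lemma mul_units i j k l : E i j * E k l = E i l *+ (j == k).
Proof. by rewrite /matrix_unit !mulrA mul_wXYw mulrnAl. Qed.

Lemma sub_monomials i j : Y ^+ i * X ^+ j - Y ^+ i.+1 * X ^+ j.+1 = E i j.
Proof. by rewrite /matrix_unit twE mulrBr mulrBl mulr1 exprSr exprS !mulrA. Qed.

(** * The kernel of rho *)

Lemma rhoX : rho X = lmono K (-1).
Proof.
by have [_ _ rs [_ _ rfs]] := rho_gens K; rewrite raddfD /= rs rfs addr0.
Qed.

Lemma rhoY : rho Y = lmono K 1.
Proof.
by have [_ re _ [_ rf _]] := rho_gens K; rewrite raddfD /= re rf addr0.
Qed.

Lemma rhow : rho w = 0.
Proof. by have [_ _ _ []] := rho_gens K. Qed.

Lemma lmonoX n : lmono K 1 ^+ n = lmono K n.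
Proof. by elim: n => [|n IH] //; rewrite exprS IH lmonoM. Qed.

Lemma lmonoVX n : lmono K (-1) ^+ n = lmono K (- n%:Z).
Proof. by elim: n => [|n IH] //; rewrite exprS IH lmonoM -opprD. Qed.

Lemma rho_monomial i j : rho (Y ^+ i * X ^+ j) = lmono K (i%:Z - j%:Z).
Proof. by rewrite rmorphM !rmorphXn /= rhoX rhoY lmonoX lmonoVX lmonoM. Qed.

Lemma rho_unit i j : rho (E i j) = 0.
Proof. by rewrite !rmorphM /= rhow mulr0 mul0r. Qed.

Lemma rhoM x y : rho (x * y) = rho x * rho y.
Proof. exact: rmorphM. Qed.

Lemma rhoZ c x : rho (c *: x) = c *: rho x.
Proof. exact: linearZ. Qed.

Lemma rho_mull x y : rho x = 0 -> rho (y * x) = 0.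
Proof. by move=> x0; rewrite rhoM x0 mulr0. Qed.

Lemma rho_mulr x y : rho x = 0 -> rho (x * y) = 0.
Proof. by move=> x0; rewrite rhoM x0 mul0r. Qed.

Lemma rho_lie x y : rho (lie x y) = 0.
Proof. by rewrite raddfB /= !rhoM mulrC subrr. Qed.

Lemma tilde_lmono n : tilde (lmono K n) = epow K n.
Proof.
rewrite /tilde /lmono msuppU oner_eq0 big_seq_fset1 mcoeffUU.
by rewrite scale1r.
Qed.

Lemma tilde0 : tilde (0 : L) = 0.
Proof. exact: linear_at0 (@tilde_linear K). Qed.

Definition units_span : T -> Prop := span_of (fun x => exists i j, x = E i j).

(** Modulo matrix units, Y^i X^j depends only on i - j, by telescoping
    [sub_monomials]. *)
Lemma monomial_shift i j m :
  units_span (Y ^+ (i + m) * X ^+ (j + m) - Y ^+ i * X ^+ j).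
Proof.
elim: m => [|m IH]; first by rewrite !addn0 subrr; apply: span0.
rewrite -(subrKA (Y ^+ (i + m) * X ^+ (j + m))) addrC !addnS.
rewrite -[X in _ + X]opprB sub_monomials; apply: span_ofB => //.
by apply: span_gen; exists (i + m)%N, (j + m)%N.
Qed.

Lemma te_exp n : te K ^+ n.+1 = Y ^+ n.+2 * X.
Proof.
elim: n => [|n IH]; first by rewrite expr1 -tYv -tYX mulrA.
by rewrite exprSr IH -mulrA tXe -tYX mulrA -exprSr.
Qed.

Lemma tes_exp n : tes K ^+ n.+1 = Y * X ^+ n.+2.
Proof.
elim: n => [|n IH]; first by rewrite expr1 -tvX -tYX mulrA.
rewrite exprSr IH -mulrA [X ^+ n.+2]exprSr -mulrA tXes [X ^+ n.+1 * _]mulrA.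
by rewrite -!exprSr.
Qed.

Lemma sub_tilde_rho x : units_span (x - tilde (rho x)).
Proof.
elim: (span_monomials x) => {x} [|c x y _ Sx _ Sy|_ [i [j ->]]].
- by rewrite raddf0 tilde0 subr0; apply: span0.
- rewrite linearP tilde_linear opprD addrACA -scalerBr; exact: span_lin.
rewrite rho_monomial tilde_lmono; case: (leqP j i) => [ji|ij].
  rewrite -(subnK ji) PoszD addrK; case: (i - j)%N => [|n] /=.
    by have := monomial_shift 0 0 j; rewrite !add0n mulr1.
  have := span_ofB (monomial_shift n.+1 0 j) (monomial_shift n.+1 0 1).
  by rewrite te_exp !addn1 !add0n expr0 expr1 !mulr1 opprB addrA subrK.
have [n ->] : exists n, j = (n.+1 + i)%N.
  by exists (j - i).-1; rewrite prednK ?subn_gt0 // subnK // ltnW.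
have -> : i%:Z - (n.+1 + i)%N%:Z = Negz n.
  by rewrite NegzE PoszD opprD addrC addrNK.
have := span_ofB (monomial_shift 0 n.+1 i) (monomial_shift 0 n.+1 1).
by rewrite /= tes_exp !addn1 !add0n expr0 expr1 !mul1r opprB addrA subrK.
Qed.

Lemma ker_rho_span x : rho x = 0 -> units_span x.
Proof. by move=> x0; have := sub_tilde_rho x; rewrite x0 tilde0 subr0. Qed.

Lemma rho_tilde (r : L) : rho (tilde r) = r.
Proof.
have H n : rho (epow K n) = lmono K n.
  have [_ re rs _] := rho_gens K.
  by case: n => n /=; rewrite rmorphXn /= ?re ?rs ?lmonoX ?lmonoVX.
by rewrite [RHS]laurentE raddf_sum; apply: eq_bigr => n _; rewrite -H -rhoZ.
Qed.

(** * T acts faithfully on the kernel of rho *)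

Local Notation evY := (horner_alg Y).

Lemma evYXn n : evY 'X^n = Y ^+ n.
Proof. by rewrite rmorphXn /= horner_algX. Qed.

Lemma evYZ c (p : {poly K}) : evY (c *: p) = c *: evY p.
Proof. by rewrite linearZ /= mulr_algl. Qed.

Lemma evYP c (p q : {poly K}) : evY (c *: p + q) = c *: evY p + evY q.
Proof. by rewrite linearP /= mulr_algl. Qed.

(** The elements Y^k w are linearly independent, with w X^k as coordinate
    functions. *)
Lemma w_evY k (p : {poly K}) : w * X ^+ k * evY p * w = p`_k *: w.
Proof.
rewrite -{1}(coefK p) poly_def linear_sum mulr_sumr mulr_suml.
have [kp|kp] := ltnP k (size p).
  rewrite (bigD1 (Ordinal kp)) //= big1 ?addr0 => [|i ik].
    by rewrite evYZ evYXn -scalerAr -scalerAl wXYw eqxx.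
  rewrite evYZ evYXn -scalerAr -scalerAl wXYw.
  have /negbTE -> : k != i by apply: contraNneq ik => ki; apply/eqP/val_inj.
  by rewrite scaler0.
rewrite nth_default // scale0r big1 //= => i _.
rewrite evYZ evYXn -scalerAr -scalerAl wXYw.
by rewrite (gtn_eqF (leq_trans (ltn_ord i) kp)) scaler0.
Qed.

Lemma evYw_eq0 (p : {poly K}) :
  (forall k, w * X ^+ k * evY p * w = 0) -> p = 0.
Proof.
move=> H; apply/polyP => k; rewrite coef0; apply/eqP.
have := H k; rewrite w_evY => /eqP.
by rewrite scaler_eq0 (negbTE (tw_neq0 K)) orbF.
Qed.

(** The left ideal T w is a copy of K[Y], since X^j w = 0 for j > 0. *)
Lemma mul_w x : exists p, x * w = evY p * w.
Proof.
elim: (span_monomials x) => {x} [|c x y _ [p Ep] _ [q Eq]|_ [i [[|j] ->]]].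
- by exists 0; rewrite linear0.
- by exists (c *: p + q); rewrite evYP !mulrDl -!scalerAl Ep Eq.
- by exists 'X^i; rewrite evYXn mulr1.
- by exists 0; rewrite linear0 exprSr -!mulrA tXw !mulr0 mul0r.
Qed.

(** Multiplying on the right by a high power of Y clears the powers of X. *)
Lemma mul_Yn x : exists N p, x * Y ^+ N = evY p.
Proof.
suff [N H] : exists N, forall n, (N <= n)%N -> exists p, x * Y ^+ n = evY p.
  by exists N; apply: H.
elim: (span_monomials x) => {x} [|c x y _ [M Hx] _ [N Hy]|_ [i [j ->]]].
- by exists 0 => n _; exists 0; rewrite mul0r linear0.
- exists (maxn M N) => n; rewrite geq_max => /andP[/Hx[p Ep] /Hy[q Eq]].
  by exists (c *: p + q); rewrite evYP mulrDl -scalerAl Ep Eq.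
- exists j => n /subnKC <-; exists 'X^(i + (n - j)).
  by rewrite evYXn exprD mulrA -(mulrA _ (X ^+ j)) XnYn mulr1 -exprD.
Qed.

(** If x kills the matrix units, it kills every Y^l w, and the polynomial
    x Y^N of [mul_Yn] is zero by [w_evY].  As x also kills the differences of
    the idempotents Y^n X^n, it equals x Y^N X^N, which is zero. *)
Lemma faithful x : (forall i j, x * E i j = 0) -> x = 0.
Proof.
move=> xE; have xYw l : x * Y ^+ l * w = 0.
  by rewrite -[RHS](xE l 0) /matrix_unit mulr1 mulrA.
have [N [p Ep]] := mul_Yn x.
have p0 : p = 0 by apply: evYw_eq0 => k; rewrite -Ep -mulrA xYw mulr0.
have xYN n : x * (Y ^+ n * X ^+ n) = x.
  elim: n => [|n IH]; first by rewrite !mulr1.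
  rewrite -[RHS]IH; apply/eqP; rewrite eq_sym -subr_eq0 -mulrBr sub_monomials.
  by rewrite xE.
by rewrite -(xYN N) mulrA Ep p0 linear0 mul0r.
Qed.

Lemma entry_inj x : (forall k l, entry x k l = 0) -> x = 0.
Proof.
move=> x0; apply: faithful => i j; rewrite /matrix_unit mulrA.
have [p Ep] := mul_w (x * Y ^+ i).
suff p0 : p = 0 by rewrite mulrA Ep p0 linear0 !mul0r.
apply: evYw_eq0 => k; rewrite -mulrA -Ep.
by rewrite !mulrA; apply: x0.
Qed.

Lemma corner x : exists c : K, w * x * w = c *: w.
Proof.
have [p Ep] := mul_w x; exists p`_0.
by rewrite -mulrA Ep -w_evY mulr1 mulrA.
Qed.

Definition wcoef x : K := sval (cid (corner x)).

Lemma wcoefE x : w * x * w = wcoef x *: w.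
Proof. exact: (svalP (cid (corner x))). Qed.

Lemma entry_diag_finite x :
  rho x = 0 -> exists n, forall m, (n <= m)%N -> entry x m m = 0.
Proof.
move=> /ker_rho_span; elim=> {x} [|c x y _ [M Hx] _ [N Hy]|_ [i [j ->]]].
- by exists 0 => m _; rewrite entry0.
- exists (maxn M N) => n; rewrite geq_max => /andP[/Hx Ex /Hy Ey].
  by rewrite entryD Ey addr0 /entry -scalerAr -!scalerAl [_ * w]Ex scaler0.
- by exists i.+1 => m im; rewrite -[E i j]mulr1 entry_mull gtn_eqF.
Qed.

(** * Commutators with X and Y *)

(** By induction on i: E 0 j = [X^(j+1), Y], and [E i j, Y] is E i (j-1) or 0
    minus E (i+1) j. *)
Lemma lie_Y_surj z : rho z = 0 -> exists a, lie a Y = z.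
Proof.
move=> /ker_rho_span; elim=> {z} [|c x y _ [a Ha] _ [b Hb]|_ [i [j ->]]].
- by exists 0; rewrite /lie mul0r mulr0 subrr.
- by exists (c *: a + b); rewrite lieDl lieZl Ha Hb.
elim: i j => [|i IH] j.
  exists (X ^+ j.+1); rewrite /lie exprSr -mulrA tXY mulr1 -exprSr.
  by rewrite exprS mulrA -{1}(mul1r (X ^+ j)) -mulrBl -twE /matrix_unit mul1r.
have EY : exists a, lie a Y = E i j * Y.
  case: j => [|j].
    exists 0; rewrite /lie mul0r mulr0 subrr.
    by rewrite /matrix_unit mulr1 -mulrA twY mulr0.
  have [a Ha] := IH j; exists a.
  by rewrite Ha /matrix_unit exprSr -!mulrA tXY mulr1.
have [a Ha] := EY; exists (a - E i j).
rewrite -[- _]scaleN1r lieDl lieZl scaleN1r Ha /lie.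
by rewrite opprB addrC subrK /matrix_unit exprS !mulrA.
Qed.

(** The polynomials in Y commute with Y, and [- Y^(i+1), X] = Y^i w. *)
Lemma lie_X_surj y : exists b, lie b Y = 0 /\ lie b X = y * w.
Proof.
elim: (span_monomials y) => {y}
  [|c x y _ [a [Ya Xa]] _ [b [Yb Xb]]|_ [i [j ->]]].
- by exists 0; rewrite /lie !mul0r !mulr0 subrr.
- exists (c *: a + b); rewrite !lieDl !lieZl Ya Yb Xa Xb.
  by rewrite scaler0 addr0 mulrDl scalerAl.
case: j => [|j]; last first.
  by exists 0; rewrite /lie !mul0r !mulr0 subrr exprSr -!mulrA tXw !mulr0.
exists (- Y ^+ i.+1); rewrite /lie !mulNr !mulrN !opprK -exprS -exprSr addNr.
split=> //; rewrite [in X * _]exprS [X * (_ * _)]mulrA tXY mul1r mulr1.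
by rewrite twE mulrBr mulr1 [in RHS]mulrA -exprSr addrC.
Qed.

(** * Lie derivations and the Leibniz rule *)

Lemma ker_rho_ind (P : T -> Prop) :
  P 0 -> (forall c x y, P x -> P y -> P (c *: x + y)) ->
  (forall i j, P (E i j)) -> forall x, rho x = 0 -> P x.
Proof.
by move=> P0 PL PE x /ker_rho_span; elim=> {x} [|c x y _ Px _ Py|_ [i [j ->]]];
  auto.
Qed.

Lemma eq_on_ker (F G : T -> T) : linear F -> linear G ->
  (forall i j, F (E i j) = G (E i j)) -> forall x, rho x = 0 -> F x = G x.
Proof.
move=> lF lG FG; apply: ker_rho_ind => [|c x y Fx Fy|i j] //.
  by rewrite !linear_at0.
by rewrite lF lG Fx Fy.
Qed.

Section LieDerivation.
Variables (D : T -> T) (HD : lie_derivation D).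
Let lD : linear D := HD.1.

(** The kernel of rho consists of commutators by [lie_Y_surj], and rho is
    a homomorphism to a commutative algebra. *)
Lemma lie_der_ker x : rho x = 0 -> rho (D x) = 0.
Proof.
by move=> /lie_Y_surj[a <-]; rewrite HD.2 raddfD /= !rho_lie addr0.
Qed.

Lemma leibniz_units i j k l :
  D (E i j * E k l) = D (E i j) * E k l + E i j * D (E k l).
Proof.
pose c i j (a b : nat) := entry (D (E i j)) a b.
have c_lie p q r s (a b : nat) :
    c p s a b *+ (q == r) - c r q a b *+ (s == p) =
    c p q a r *+ (b == s) - c p q s b *+ (a == r)
    + (c r s q b *+ (a == p) - c r s a p *+ (b == q)).
  have := HD.2 (E p q) (E r s).
  rewrite /lie !mul_units (linear_atB lD) !(linear_atMn lD).
  move=> /(congr1 (fun x => entry x a b)).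
  by rewrite !(entryB, entryD, entryMn) !entry_mull !entry_mulr.
have c_fin p : exists n, forall m, (n <= m)%N -> c p p m m = 0.
  exact/entry_diag_finite/lie_der_ker/rho_unit.
apply/eqP; rewrite -subr_eq0; apply/eqP/entry_inj => a b.
rewrite mul_units entryB entryD (linear_atMn lD) entryMn entry_mulr entry_mull.
by rewrite (coef_leibniz c_lie c_fin) subrr.
Qed.

Lemma leibniz_ker x y : rho x = 0 -> rho y = 0 ->
  D (x * y) = D x * y + x * D y.
Proof.
move=> x0 y0; move: y y0 x x0.
apply: ker_rho_ind => [|c y z Hy Hz|k l] x x0.
- by rewrite (linear_at0 lD) !mulr0 (linear_at0 lD) addr0.
- rewrite mulrDr -scalerAr !lD Hy // Hz // !mulrDr scalerDr addrACA.
  by rewrite -!scalerAr.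
move: x x0; apply: ker_rho_ind => [|c x y Hx Hy|i j].
- by rewrite (linear_at0 lD) !mul0r (linear_at0 lD) addr0.
- rewrite mulrDl -scalerAl !lD Hx Hy !mulrDl scalerDr addrACA.
  by rewrite -!scalerAl.
exact: leibniz_units.
Qed.

(** What prevents D from satisfying the Leibniz rule at (a, x), up to sign. *)
Definition defect a x : T := D a * x - D (a * x) + a * D x.

(** The Lie property of D says exactly that its Leibniz defect is symmetric in
    its two arguments. *)
Lemma defectC a x : defect a x = x * D a - D (x * a) + D x * a.
Proof.
have /eqP := HD.2 a x; rewrite /lie (linear_atB lD) subr_eq => /eqP H.
rewrite /defect [LHS]addrAC [RHS]addrAC; apply/eqP.
rewrite subr_eq [X in _ == X]addrAC eq_sym subr_eq H.
by rewrite addrA [X in _ + X + _ == _]addrACA -opprD subrKC.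
Qed.

Lemma defect_mulr a x y : rho x = 0 -> rho y = 0 ->
  defect a (x * y) = defect a x * y.
Proof.
move=> x0 y0; rewrite /defect (mulrA a) (leibniz_ker (rho_mull a x0) y0).
rewrite (leibniz_ker x0 y0) !mulrDr !mulrDl mulNr !mulrA.
by rewrite [a * D x * y + _]addrC opprD !addrA subrK.
Qed.

Lemma defect_mull a x y : rho x = 0 -> rho y = 0 ->
  defect a (x * y) = x * defect a y.
Proof.
move=> x0 y0; rewrite !defectC -(mulrA x y a) (leibniz_ker x0 (rho_mulr a y0)).
rewrite (leibniz_ker x0 y0) !mulrDr !mulrDl mulrN !mulrA.
by rewrite [D x * y * a + x * _]addrC opprD !addrA subrK.
Qed.

Definition scalar_part a : K := wcoef (defect a w).

(** By the Leibniz rule on ker rho, the defect of a is left and right linear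
    over ker rho.  Writing E i j = E i 0 w w w E 0 j, it is therefore determined
    by its value at w, which lies in w T w = K w. *)
Lemma defectE a x : rho x = 0 -> defect a x = scalar_part a *: x.
Proof.
move: x; apply: eq_on_ker.
- move=> c x y; rewrite /defect !(mulrDr, lD) -!scalerAr lD.
  rewrite scalerDr scalerBr [RHS]addrACA; congr (_ + _).
  by rewrite [RHS]addrACA -opprD.
- by move=> c x y; rewrite scalerDr !scalerA mulrC.
move=> i j; have wE : E i j = E i 0 * (w * w * w) * E 0 j.
  rewrite !tww /matrix_unit !expr0 mulr1 mul1r -!mulrA.
  by rewrite !(mulrA w w) tww (mulrA w w) tww.
have w0 := rhow; have E0 := rho_unit.
have ww0 : rho (w * w) = 0 by rewrite tww.
have www0 : rho (w * w * w) = 0 by rewrite !tww.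
rewrite {1}wE (defect_mulr a (rho_mull _ www0)) // defect_mull //.
rewrite defect_mulr // defect_mull // wcoefE -scalerAr -scalerAl.
by congr (_ *: _); rewrite wE !tww.
Qed.

Lemma scalar_part_linear c a b :
  scalar_part (c *: a + b) = c * scalar_part a + scalar_part b.
Proof.
have H x : scalar_part x *: w = defect x w by rewrite (defectE x rhow).
apply/eqP; rewrite -subr_eq0; apply/eqP.
suff /eqP : (scalar_part (c *: a + b)
    - (c * scalar_part a + scalar_part b)) *: w = 0.
  by rewrite scaler_eq0 (negbTE (tw_neq0 K)) orbF => /eqP.
rewrite scalerBl scalerDl -scalerA !H; apply/eqP; rewrite subr_eq0; apply/eqP.
rewrite /defect !(mulrDl, lD) -!scalerAl lD scalerDr scalerBr [RHS]addrACA.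
by congr (_ + _); rewrite [RHS]addrACA -opprD.
Qed.

Lemma scalar_part_ker x : rho x = 0 -> scalar_part x = 0.
Proof.
move=> x0; apply/eqP; have := defectE x rhow => /esym/eqP.
rewrite /defect (leibniz_ker x0 rhow) opprD addrA subrr add0r addNr.
by rewrite scaler_eq0 (negbTE (tw_neq0 K)) orbF.
Qed.

(** On ker rho, D(a) - c(a) 1 acts by x |-> D(a x) - a D(x), an expression for
    which the Leibniz rule in a is formal; faithfulness lifts the rule to T. *)
Lemma sub_scalar_derivation : derivation (fun a => D a - (scalar_part a)%:A).
Proof.
split=> [c a b|a b].
  by rewrite lD scalar_part_linear scalerDl -scalerA opprD addrACA scalerBr.
have kE c x : rho x = 0 ->
    (D c - (scalar_part c)%:A) * x = D (c * x) - c * D x.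
  move=> x0; rewrite mulrBl -scalerAl mul1r -(defectE c x0) /defect.
  by rewrite opprD opprB addrA subrKC.
apply/eqP; rewrite -subr_eq0; apply/eqP/faithful => i j.
have E0 := rho_unit i j.
rewrite mulrBl kE // mulrDl -!mulrA (kE a _ (rho_mull b E0)) (kE b _ E0).
by rewrite mulrBr subrKA !mulrA subrr.
Qed.

(** The scalar part vanishes on ker rho, so it factors through rho, with tilde
    as a section. *)
Lemma lie_der_split : exists D' (l : subspace (functionals K)),
  derivation D' /\ D = D' + central l.
Proof.
have fl : (fun p : L => scalar_part (tilde p) : K^o) \in functionals K.
  apply/asboolP => c p q.
  by rewrite tilde_linear scalar_part_linear.
exists (fun a => D a - (scalar_part a)%:A), (Subspace fl); split.
  exact: sub_scalar_derivation.
apply/funext => a; rewrite !fctE /central /=.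
suff -> : scalar_part (tilde (rho a)) = scalar_part a by rewrite subrK.
rewrite -{2}(subrK (tilde (rho a)) a) -[a - _]scale1r scalar_part_linear.
have k0 : rho (a - tilde (rho a)) = 0 by rewrite raddfB /= rho_tilde subrr.
by rewrite (scalar_part_ker k0) mulr0 add0r.
Qed.

End LieDerivation.

(** * Associative derivations *)

(** Subtracting an inner derivation and partial_r makes the derivation kill Y.
    Its value y at X then satisfies y Y = 0, so that y = y w, and
    [lie_X_surj] gives a second inner derivation that still kills Y. *)
Lemma derivation_split (D : T -> T) :
  derivation D -> exists a r, D = ad a + partial r.
Proof.
move=> dD; set r := rho (D Y).
have /lie_Y_surj[a aY] : rho (D Y - tilde r) = 0.
  by rewrite raddfB /= rho_tilde subrr.
pose D1 := D + ad (- a).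
have dD1 : derivation D1 by apply/derivationD/ad_derivation.
have adN (b x : T) : ad (- b) x = - ad b x.
  by rewrite /ad /lie mulNr mulrN opprB opprK addrC.
have D1Y : D1 Y = tilde r by rewrite /D1 !fctE adN /ad aY subKr.
pose y := D1 X + X * tilde r * X.
have yY : y * Y = 0.
  rewrite /y mulrDl -(mulrA _ X) tXY mulr1 -D1Y -dD1.2 tXY.
  exact: derivation1.
have [b [bY bX]] := lie_X_surj y.
exists (a + b), r.
have -> : partial r = D1 + ad (- b).
  apply/esym/partial_unique; first by apply/derivationD/ad_derivation.
    by rewrite !fctE adN /ad bY oppr0 addr0.
  rewrite !fctE adN /ad bX twE mulrBr mulr1 mulrA yY mul0r subr0 /y.
  by rewrite opprD addrA subrr add0r.
apply/funext => x; rewrite /D1 !fctE !adN /ad lieDl.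
by rewrite -[X in _ = _ + X]addrA -opprD subrKC.
Qed.

(** If D kills ker rho, then D(x) E i j = D(x E i j) = 0. *)
Lemma derivation_ker0 (D : T -> T) :
  derivation D -> (forall i j, D (E i j) = 0) -> D = 0.
Proof.
move=> [lD dD] DE; apply/funext => x; apply: faithful => i j.
have : D (x * E i j) = 0.
  apply: (eq_on_ker (F := D) (G := fun=> 0)) => //.
    by move=> c u z; rewrite scaler0 addr0.
  exact/rho_mull/rho_unit.
by rewrite dD DE mulr0 addr0.
Qed.

(** * The decomposition *)

Lemma central_lie_derivation l : lie_derivation (@central K l).
Proof.
case: l => l ll; have /asboolP lin_l := ll; split=> [c x y|x y].
  by rewrite /central /= linearP lin_l scalerDl -scalerA.
rewrite /central /= rho_lie.
by rewrite (linear_at0 lin_l) scale0r /lie !mulr_algl !mulr_algr !subrr addr0.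
Qed.

(** If a is central, then a w = w a w is a multiple c w, and hence
    a E i j = c E i j; conclude by faithfulness. *)
Lemma commutant_scalar a : (forall x, lie a x = 0) -> exists c : K, a = c%:A.
Proof.
move=> a0; have aC x : a * x = x * a by apply/subr0_eq/a0.
exists (wcoef a); apply/eqP; rewrite -subr_eq0; apply/eqP/faithful => i j.
rewrite mulrBl mulr_algl /matrix_unit !mulrA aC -!mulrA.
have aw : a * w = wcoef a *: w by rewrite -wcoefE -aC -mulrA tww.
by rewrite (mulrA a) aw -!scalerAl -!scalerAr subrr.
Qed.

Lemma functional_linear (l : subspace (functionals K)) :
  linear (subspace_val l : L -> K^o).
Proof. by have /asboolP := subspace_valP l. Qed.

(** On ker rho the functional part vanishes, so the derivation
    ad a + partial r does too, and it is zero by [derivation_ker0]. *)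
Lemma sum_eq0 a (r : L) (l : subspace (functionals K)) :
  ad a + partial r + central l = 0 ->
  [/\ exists c : K, a = c%:A, r = 0 & l = 0].
Proof.
move=> H0; set D := ad a + partial r.
have HD x : D x + central l x = 0 by have := congr1 (fun F => F x) H0.
have dD : derivation D.
  by apply: derivationD; [apply: ad_derivation|apply: partial_derivation].
have lrho0 x : rho x = 0 -> central l x = 0.
  move=> x0; rewrite /central x0; have ll := functional_linear l.
  by rewrite (linear_at0 ll) scale0r.
have D0 : D = 0.
  apply: derivation_ker0 => // i j; have := HD (E i j).
  by rewrite lrho0 ?rho_unit // addr0.
have r0 : r = 0.
  have := congr1 (fun F => rho (F Y)) D0.
  by rewrite /D !fctE raddfD /= partialY rho_tilde /ad rho_lie add0r raddf0.
have ada : ad a = 0.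
  by have := D0; rewrite /D r0 (linear_at0 (@partial_linear K)) addr0.
split=> //.
  by apply: commutant_scalar => x; have := congr1 (fun F => F x) ada.
apply: val_inj; apply/funext => p /=.
have := HD (tilde p); rewrite D0 add0r /central rho_tilde => /eqP.
by rewrite scaler_eq0 oner_eq0 orbF => /eqP.
Qed.

Lemma centralB l m : central (l - m) = central l - @central K m.
Proof. by apply/funext => x; rewrite !fctE /central scalerBl. Qed.

Lemma sum_inj a r l b s m :
  ad a + partial r + @central K l = ad b + partial s + central m ->
  [/\ exists c : K, a - b = c%:A, r = s & l = m].
Proof.
move=> H; have [|c r0 l0] := @sum_eq0 (a - b) (r - s) (l - m).
  rewrite adB (linear_atB (@partial_linear K)) centralB.
  by rewrite [X in X + _]addrACA -opprD addrACA -opprD H subrr.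
by split=> //; apply/eqP; rewrite -subr_eq0; apply/eqP.
Qed.

Lemma lie_der_sum (D : T -> T) : lie_derivation D ->
  exists a r l, D = ad a + partial r + @central K l.
Proof.
move=> /lie_der_split[D' [l [/derivation_split[a [r ->]] ->]]].
by exists a, r, l.
Qed.

Lemma sum_lie_der a (r : L) l : ad a + partial r + @central K l \in lie_der T.
Proof.
have H (D : T -> T) : lie_derivation D -> D \in lie_der T.
  by move=> ?; apply/asboolP.
apply: rpredD; first apply: rpredD; apply: H.
- exact/derivation_lie/ad_derivation.
- exact/derivation_lie/partial_derivation.
- exact: central_lie_derivation.
Qed.

Lemma lie_der_direct_sum :
  direct_sum3 (lie_der T) (inner_der T) (partials K) (centrals K).
Proof.
split=> [_ /asboolP[a ->]|_ /asboolP[r ->]|_ /asboolP[l ->]|D].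
- exact/asboolP/derivation_lie/ad_derivation.
- exact/asboolP/derivation_lie/partial_derivation.
- exact/asboolP/central_lie_derivation.
move=> /asboolP/lie_der_sum[a [r [l ->]]].
exists (ad a, partial r, central l); split=> /= [|[[A P] C] /=].
  by split=> //; apply/asboolP; eexists.
case=> /asboolP[b ->] /asboolP[s ->] /asboolP[m ->] /sum_inj[[c ab] -> ->].
suff -> : ad a = ad b by [].
by apply/eqP; rewrite -subr_eq0 -adB ab ad_scalar.
Qed.

Local Notation Q := (quotspace (scalars K)).
Local Notation source :=
  (Q * (subspace (vfields K) * subspace (functionals K)))%type.

(** A derivation r d/dt is turned back into r by evaluating it at t. *)
Definition sum_map (p : source) : subspace (lie_der T) :=
  Subspace (sum_lie_der (repr p.1) (subspace_val p.2.1 (lmono K 1)) p.2.2).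

Lemma sum_mapE a V l :
  subspace_val (sum_map (quotspace_pi (scalars K) a, (V, l)))
  = ad a + partial (subspace_val V (lmono K 1)) + central l.
Proof.
rewrite /=; congr (_ + _ + _); apply/eqP; rewrite -subr_eq0 -adB.
have /quotspace_piE/asboolP[c ->] := quotspace_piK (quotspace_pi (scalars K) a).
by rewrite ad_scalar.
Qed.

Lemma vfield_t (r : L) : vfield r (lmono K 1) = r.
Proof. by rewrite /vfield ddt_lmono subrr scale1r mulr1. Qed.

Lemma sum_map_linear : linear sum_map.
Proof.
move=> c [u [V l]] [u' [V' l']]; apply: val_inj.
rewrite -(quotspace_piK u) -(quotspace_piK u').
set a := repr u; set b := repr u'.
rewrite (_ : c *: _ + _ = (quotspace_pi (scalars K) (c *: a + b),
                           (c *: V + V', c *: l + l'))); last first.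
  by rewrite quotspace_piD -quotspace_piZ.
rewrite [RHS](_ : _ = c *: subspace_val (sum_map (quotspace_pi _ a, (V, l)))
  + subspace_val (sum_map (quotspace_pi _ b, (V', l')))); last by [].
rewrite [LHS]sum_mapE !sum_mapE.
have -> : ad (c *: a + b) = c *: ad a + ad b.
  by apply/funext => x; rewrite !fctE /ad lieDl lieZl.
have -> : central (c *: l + l') = c *: central l + central l'.
  by apply/funext => x; rewrite !fctE /central scalerDl scalerA.
rewrite (_ : subspace_val (c *: V + V') (lmono K 1) =
  c *: subspace_val V (lmono K 1) + subspace_val V' (lmono K 1)); last by [].
rewrite partial_linear !scalerDr.
by rewrite [RHS]addrACA; congr (_ + _); rewrite [RHS]addrACA.
Qed.

HB.instance Definition _ :=
  GRing.isLinear.Build K source (subspace (lie_der T)) _ sum_map sum_map_linear.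

Lemma vfieldK (V : subspace (vfields K)) :
  Subspace (vfield_in (subspace_val V (lmono K 1))) = V.
Proof.
apply: val_inj => /=; have /asboolP[r ->] := subspace_valP V.
by rewrite vfield_t.
Qed.

Lemma sum_map_inj : injective sum_map.
Proof.
move=> [u [V l]] [u' [V' l']] /(congr1 (@subspace_val _ _ _)).
rewrite -(quotspace_piK u) -(quotspace_piK u') !sum_mapE.
move=> /sum_inj[ab r_eq ->].
rewrite -(vfieldK V) -(vfieldK V') r_eq.
by have /quotspace_piE -> : repr u - repr u' \in scalars K by apply/asboolP.
Qed.

Lemma sum_map_surj (D : subspace (lie_der T)) : exists p, sum_map p = D.
Proof.
have /asboolP/lie_der_sum[a [r [l DE]]] := subspace_valP D.
exists (quotspace_pi (scalars K) a, (Subspace (vfield_in r), l)).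
by apply: val_inj; rewrite [LHS]sum_mapE /= vfield_t DE.
Qed.

Lemma sum_map_bij : bijective sum_map.
Proof.
have [g gK] := choice sum_map_surj.
by exists g => // p; apply: sum_map_inj; rewrite gK.
Qed.

End Toeplitz.

Theorem theorem5p4 (K : fieldType) :
  (forall D : toeplitz K -> toeplitz K, lie_derivation D ->
     exists (a : toeplitz K) (r : laurent K) (l : subspace (functionals K)),
       D = ad a + partial r + central l)
  /\
  direct_sum3 (lie_der (toeplitz K))
    (inner_der (toeplitz K)) (partials K) (centrals K)
  /\
  (exists Phi : {linear (quotspace (scalars K) *
                         (subspace (vfields K) * subspace (functionals K)))%type
                        -> subspace (lie_der (toeplitz K))},
     bijective Phi /\
     forall (a : toeplitz K) (r : laurent K) (l : subspace (functionals K)),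
       subspace_val
         (Phi (quotspace_pi (scalars K) a, (Subspace (vfield_in r), l)))
       = ad a + partial r + central l).
Proof.
split; first exact: lie_der_sum.
split; first exact: lie_der_direct_sum.
exists (@sum_map K); split=> [|a r l]; first exact: sum_map_bij.
by rewrite [LHS]sum_mapE /= vfield_t.
Qed.
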